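(* Let $d\ge 2$, $q\ge 2$, and let $\mathbb{P}$ be a translation-invariant probability measure on $\Omega=\{0,1,\dots,q-1\}^{\mathbb{Z}^d}$. Suppose that $\mathbb{P}$ has the finite-energy property and the boundary-$1$ Markov property, and that the limit $$\mu=\lim_{n\to\infty}[\mathbb{P}(|C|=n)]^{1/n}=\lim_{n\to\infty}[\mathbb{P}(n\le|C|<\infty)]^{1/n}$$ exists for some $0<\mu\le1$ (both limits exist and are equal). Then $\mu$ also satisfies $$\lim_{n\to\infty}\frac{\mathbb{P}(|C_{\mathrm{le}}(0)|=n+1)}{\mathbb{P}(|C_{\mathrm{le}}(0)|=n)}=\lim_{n\to\infty}\frac{\mathbb{P}(n+1\le|C_{\mathrm{le}}(0)|<\infty)}{\mathbb{P}(n\le|C_{\mathrm{le}}(0)|<\infty)}=\mu.$$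
   Context: Setting: $S=\{0,1,\dots,q-1\}$, $\Omega=S^{\mathbb{Z}^d}$; for $V\subset\mathbb{Z}^d$, $\omega_V$ is the restriction of $\omega\in\Omega$ to $V$. Finite-energy property: there exists $h\in(0,1)$ such that for all $s\in S$, $h\le\inf_{\sigma\in\Omega}\mathbb{P}(\omega(x)=s\mid\omega_{\mathbb{Z}^d\setminus\{x\}}=\sigma_{\mathbb{Z}^d\setminus\{x\}})\le\sup_{\sigma\in\Omega}\mathbb{P}(\omega(x)=s\mid\omega_{\mathbb{Z}^d\setminus\{x\}}=\sigma_{\mathbb{Z}^d\setminus\{x\}})\le 1-h$ (by translation invariance the site $x$ is irrelevant). Boundary-$s$ Markov property ($s\in S$): for finite $V\subset\mathbb{Z}^d$ let $N_V=\bigcup_{x\in V}(N_x\setminus V)$, where $N_x=\{y\in\mathbb{Z}^d:|y-x|=1\}$. $\mathbb{P}$ has the boundary-$s$ Markov property if for every finite $V\subset\mathbb{Z}^d$, given that all sites of $N_V$ are in the state $s$, the configuration on $V$ is conditionally independent of the configuration on $\mathbb{Z}^d\setminus(V\cup N_V)$. Clusters: a site $x$ is occupied if $\omega(x)=1$. $C(x)$ is the set of occupied sites that can be connected to $x$ by a nearest-neighbour path in $\mathbb{Z}^d$ passing only through occupied sites; $C(x)=\varnothing$ if $\omega(x)\ne 1$. $C=C(0)$, and $|X|$ is the number of sites of $X$. The left-endpoint of a finite set $A\subset\mathbb{Z}^d$ is the minimum of $A$ in the lexicographic order. $C_{\mathrm{le}}(x)=C(x)$ if $x$ is the left-endpoint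 of $C(x)$, and $C_{\mathrm{le}}(x)=\varnothing$ otherwise. *)

(* Defs.v *)
From HB Require Import structures.
From mathcomp Require Import all_boot all_order all_algebra.
From mathcomp Require Import all_classical all_reals all_analysis.
Set Implicit Arguments.
Unset Strict Implicit.
Unset Printing Implicit Defensive.
Import Order.TTheory GRing.Theory Num.Theory.
Import numFieldNormedType.Exports.
Local Open Scope classical_set_scope.
Local Open Scope ring_scope.

(* 'rV[int]_d plays the role of Z^d, and 'I_q that of S = {0, ..., q-1}.      *)
(* The alias [state hq] of 'I_q carries the proof that S is inhabited, since  *)
(* MathComp-Analysis measurable types are pointed.                            *)
Definition state (q : nat) (hq : (2 <= q)%N) : Type := 'I_q.
HB.instance Definition _ (q : nat) (hq : (2 <= q)%N) := Finite.on (state hq).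
HB.instance Definition _ (q : nat) (hq : (2 <= q)%N) :=
  isPointed.Build (state hq) (Ordinal (ltnW hq)).

Definition state1 (q : nat) (hq : (2 <= q)%N) : state hq := Ordinal hq.

Definition coord_events (d q : nat) (hq : (2 <= q)%N) (V : set 'rV[int]_d) :
    set (set ('rV[int]_d -> state hq)) :=
  [set E | exists x s, V x /\ E = [set w | w x = s]].

(* The sigma-algebra generated by the restriction of w to V. *)
Definition sigma_of (d q : nat) (hq : (2 <= q)%N) (V : set 'rV[int]_d) :
    set (set ('rV[int]_d -> state hq)) :=
  <<s @coord_events d q hq V >>.

(* Omega, with its product sigma-algebra. *)
Definition config (d q : nat) (hq : (2 <= q)%N) : Type :=
  g_sigma_algebraType (@coord_events d q hq setT).

Section model.
Context (R : realType) (d q : nat) (hq : (2 <= q)%N).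

Notation site := 'rV[int]_d.
Notation Omega := (@config d q hq).

Implicit Types (P : probability Omega R) (V A : set site) (x y : site).

Definition prob P (E : set Omega) : R := fine (P E).

Definition cond_prob P (B E : set Omega) : R := prob P (E `&` B) / prob P B.

Definition translate (a : site) (w : Omega) : Omega := fun x => w (x + a).

Definition translation_invariant P : Prop :=
  forall (a : site) (E : set Omega), measurable E -> P (translate a @^-1` E) = P E.

(* f is a version of the conditional probability                              *)
(*   sigma |-> P(w(x) = s | w = sigma off x),                                 *)
(* i.e. of the conditional expectation of 1_{w(x) = s} given the              *)
(* sigma-algebra of the sites other than x.                                   *)
Definition is_site_cond_prob P x (s : state hq) (f : Omega -> R) : Prop :=
  [/\ measurable_fun setT
        (f : g_sigma_algebraType (@coord_events d q hq (~` [set x])) -> R),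
      P.-integrable setT (EFin \o f)
    & forall E, @sigma_of d q hq (~` [set x]) E ->
        (\int[P]_(w in E) (f w)%:E = P (E `&` [set w | w x = s]))%E].

(* Conditional probabilities being defined up to null sets only, the bounds   *)
(* over all boundary conditions are required of some version.                 *)
Definition finite_energy P : Prop :=
  exists h : R, 0 < h < 1 /\
    forall (x : site) (s : state hq), exists f : Omega -> R,
      [/\ is_site_cond_prob P x s f,
          (h%:E <= ereal_inf [set (f w)%:E | w in [set: Omega]])%E
        & (ereal_sup [set (f w)%:E | w in [set: Omega]] <= (1 - h)%:E)%E].

(* |y - x| = 1; for integer vectors the l1 and Euclidean norms give the same  *)
(* relation, whereas the norm of MathComp-Analysis on 'rV is the sup norm.    *)
Definition neighbor x y : bool := \sum_(i < d) `|y ord0 i - x ord0 i| == 1 :> int.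

Definition outer_boundary V : set site :=
  \bigcup_(x in V) ([set y | neighbor x y] `\` V).

Definition boundary_markov P (s : state hq) : Prop :=
  forall V, finite_set V ->
  let B : set Omega := [set w | forall y, outer_boundary V y -> w y = s] in
  (0 < P B)%E ->
  forall E F : set Omega,
    sigma_of V E -> sigma_of (~` (V `|` outer_boundary V)) F ->
    cond_prob P B (E `&` F) = cond_prob P B E * cond_prob P B F.

Definition occupied (w : Omega) x : bool := w x == state1 hq.

(* Empty when x itself is not occupied. *)
Definition occ_cluster (w : Omega) x : set site :=
  [set y | exists p : seq site,
    [/\ path neighbor x p, last x p = y & all (occupied w) (x :: p)]].

Definition lex_le x y : bool :=
  (([tuple x ord0 i | i < d] : d.-tuplelexi int)
     <= ([tuple y ord0 i | i < d] : d.-tuplelexi int))%O.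

Definition is_left_endpoint A x : Prop :=
  [/\ finite_set A, A x & forall y, A y -> lex_le x y].

Definition left_cluster (w : Omega) x : set site :=
  if `[< is_left_endpoint (occ_cluster w x) x >] then occ_cluster w x else set0.

(* {|X| = n} *)
Definition size_eq (X : Omega -> set site) (n : nat) : set Omega :=
  [set w | (X w #= `I_n)%card].

(* {n <= |X| < oo} *)
Definition size_ge_fin (X : Omega -> set site) (n : nat) : set Omega :=
  [set w | finite_set (X w) /\ (`I_n #<= X w)%card].

End model.

(* Main.v *)
Require Import Defs.
From HB Require Import structures.
From mathcomp Require Import all_boot all_order all_algebra finmap zify ring lra.
From mathcomp Require Import all_classical all_reals all_analysis.
Import Order.TTheory GRing.Theory Num.Theory.
Import numFieldNormedType.Exports.
Local Open Scope classical_set_scope.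
Local Open Scope ring_scope.
Set Implicit Arguments.
Unset Strict Implicit.
Unset Printing Implicit Defensive.

(** Write [w A] for the probability that a finite connected set [A] of sites
    containing the origin (an animal) is the cluster of the origin, and [b n]
    for the sum of [w A] over the animals of size [n], so that
    [b n = P (|C| = n)]. By translation invariance [b n = n * a n] with
    [a n = P (|C_le(0)| = n)] ([mass_left]), hence the first limit is the limit of
    [phi n = b n.+1 / b n]. The second one follows, since the tails of a summable
    sequence inherit the limit of its ratios ([tail_ratio_limit]).

    As [b n `^ n%:R^-1] tends to [mu], it suffices that [phi] cannot drop fast,
    namely [phi n ^ 2 - D / n <= phi n * phi n.+1] for some constant [D]
    ([ratio_limit]). This comes from a local exchange. Call [x] a hole of [A] when
    the unit cube around [x], except [x] itself, is contained in [A], and a full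
    cube when the whole unit cube is; let [u A] and [v A] be their numbers. Filling
    a hole turns it into a full cube, and digging the centre of a full cube leaves
    a connected set, because in dimension at least two the punctured cube is
    connected. The boundary Markov property at the single site [x], whose
    neighbours are all occupied, shows that filling multiplies the weight by a
    constant [rho] ([weight_fill]). Counting pairs (animal, marked centre) in two
    ways ([swap_sum]), once and twice, shows that up to errors [O(1 / n)] the ratio
    [phi n] is at most [rho] times the mean of [u / v] over the animals of size
    [n] with their normalized weights, and that [phi n * phi n.+1] is at least
    [rho ^ 2] times the mean of [(u / v) ^ 2]. The Cauchy-Schwarz inequality
    concludes ([ratio_step]).

    The errors are under control when [v A] is at least a fixed fraction of [n]
    for all but a negligible proportion of the animals: a pattern theorem
    ([few_full]). By the finite-energy property, filling the whole cube around a
    site of [A] changes the weight by a bounded factor ([weight_insert]). An animal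
    with few full cubes has about [n] sites where this can be done, but the result
    has few full cubes, so few preimages: each insertion multiplies the mass by a
    large factor ([sparse_iter]). A small multiple of [n] insertions in succession
    yields an exponential factor, and the limit of the roots leaves no room for it
    unless the initial mass was exponentially small compared with [b n]. *)

(** * Roots and ratios of sequences *)

Section Sequences.
Context {R : realType}.
Implicit Types (b u : nat -> R) (mu : R).

Lemma cvg_seqP u (l : R) :
  (u @ \oo --> l) <->
  (forall e : R, 0 < e -> exists N, forall n, (N <= n)%N -> `|l - u n| <= e).
Proof.
split=> [/cvgrPdist_le h e e0|h].
  by have [N _ hN] := h e e0; exists N => n Nn; exact: hN.
apply/cvgrPdist_le => e e0; have [N hN] := h e e0.
by exists N => // n Nn; exact: hN.
Qed.

Lemma powR_root (x : R) n : 0 <= x -> (0 < n)%N -> (x `^ n%:R^-1) ^+ n = x.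
Proof.
move=> x0 n0; rewrite -powR_mulrn ?powR_ge0// -powRrM mulVf ?powRr1//.
by rewrite pnatr_eq0 -lt0n.
Qed.

Lemma root_lim_bounds b mu t : (forall n, 0 <= b n) -> 0 < mu -> 1 < t ->
  (fun n => b n `^ n%:R^-1) @ \oo --> mu ->
  exists N, forall n, (N <= n)%N -> (mu / t) ^+ n <= b n <= (mu * t) ^+ n.
Proof.
move=> b0 mu0 t1 /cvg_seqP h.
have t0 : 0 < t by lra.
have tV : t^-1 < 1 by rewrite invf_lt1.
pose e : R := Num.min (mu - mu / t) (mu * t - mu).
have e0 : 0 < e by rewrite lt_min !subr_gt0 gtr_pMr // tV ltr_pMr.
have [N hN] := h e e0; exists N.+1 => n Nn.
have n0 : (0 < n)%N by apply: leq_trans Nn.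
have := hN n (ltnW Nn); rewrite ler_distl => /andP[lo hi].
have e1 : e <= mu - mu / t by rewrite ge_min lexx.
have e2 : e <= mu * t - mu by rewrite ge_min lexx orbT.
set r := b n `^ n%:R^-1 in lo hi.
have r0 : 0 <= r by exact: powR_ge0.
have lo0 : 0 <= mu / t by rewrite divr_ge0 // ltW.
have hi0 : 0 <= mu * t by rewrite mulr_ge0 // ltW.
rewrite -(powR_root (b0 n) n0) -/r.
by apply/andP; split; apply: lerXn2r; rewrite ?nnegrE //; lra.
Qed.

(** Ratios that stay off their limit over a fraction [1/M] of the indices gain
    a power of [q]; taking [t] close to [1], this power exceeds the errors
    [t ^+ n] that [root_lim_bounds] leaves. *)
Lemma root_gap (q : R) M : 1 < q -> (0 < M)%N -> exists2 t, 1 < t &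
  forall n, (M <= n)%N -> t ^+ (4 * n) <= q ^+ (n %/ M).
Proof.
move=> q1 M0; have q0 : 0 < q by lra.
(* for [M <= n] we have [n < 2 * M * (n %/ M)], hence the exponent [8 * M] *)
have M8 : (0 < 8 * M)%N by lia.
have p1 (x : R) : 1 `^ x = 1 by rewrite powR1.
exists (q `^ (8 * M)%:R^-1).
  rewrite -[ltLHS](p1 (8 * M)%:R^-1).
  by apply: gt0_ltr_powR; rewrite ?nnegrE ?invr_gt0 ?ltr0n //; lra.
move=> n Mn; set t := _ `^ _.
have t1 : 1 <= t.
  rewrite -[leLHS](p1 (8 * M)%:R^-1).
  by apply: ge0_ler_powR; rewrite ?nnegrE ?invr_ge0 //; lra.
have -> : q = t ^+ (8 * M) by rewrite powR_root // ltW.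
rewrite -exprM ler_weXn2l //.
have k0 : (0 < n %/ M)%N by rewrite divn_gt0.
have := divn_eq n M; have := ltn_pmod n M0; nia.
Qed.

Lemma poly_le_expr (t : R) : 1 < t ->
  exists N, forall n, (N <= n)%N -> (n%:R + 1) * n%:R ^+ 3 <= t ^+ n.
Proof.
(* the sixth power of Bernoulli's inequality leaves two spare factors [n],
   which absorb the constants *)
move=> t1; pose s := t `^ 6%:R^-1; have t0 : 0 <= t by lra.
have s1 : 1 < s.
  have -> : 1 = 1 `^ 6%:R^-1 :> R by rewrite powR1.
  by apply: gt0_ltr_powR; rewrite ?nnegrE ?invr_gt0 ?ltr0n //; lra.
have st : s ^+ 6 = t by rewrite /s powR_root.
pose c := s - 1; have c0 : 0 < c by rewrite subr_gt0.
have c6 : 0 < c ^+ 6 by rewrite exprn_gt0.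
exists (Num.bound (2 / c ^+ 6)).+1 => n nN.
have n1 : 1 <= n%:R :> R by rewrite ler1n; apply: leq_trans nN.
have hn : 2 / c ^+ 6 <= n%:R.
  apply: ltW; apply: lt_le_trans (archi_boundP _) _; last by rewrite ler_nat ltnW.
  by rewrite divr_ge0 // ltW.
have bern : n%:R * c <= s ^+ n.
  elim: n {nN n1 hn} => [|n IH]; first by rewrite mul0r expr0.
  rewrite -natr1 mulrDl mul1r exprS.
  have -> : s * s ^+ n = s ^+ n + c * s ^+ n by rewrite /c; ring.
  by apply: lerD => //; apply: ler_peMr; [exact: ltW|apply: exprn_ege1; exact: ltW].
have : (n%:R * c) ^+ 6 <= t ^+ n.
  rewrite -st -exprM mulnC exprM; apply: lerXn2r; rewrite ?nnegrE ?exprn_ge0 //.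
    by rewrite mulr_ge0 // ltW.
  lra.
apply: le_trans; move: hn; rewrite ler_pdivrMr // exprMn => hn.
have n3 : 0 <= n%:R ^+ 3 :> R by rewrite exprn_ge0.
have -> : n%:R ^+ 6 * c ^+ 6 = n%:R ^+ 2 * (n%:R * c ^+ 6) * n%:R ^+ 3 by ring.
apply: ler_wpM2r => //; apply: (@le_trans _ _ (n%:R ^+ 2 * 2)).
  rewrite expr2; nra.
by apply: ler_wpM2l => //; rewrite exprn_ge0.
Qed.

Lemma ratio_prod_ge b c n k : 0 <= c ->
  (forall j, (j < k)%N -> c * b (n + j)%N <= b (n + j).+1) ->
  c ^+ k * b n <= b (n + k)%N.
Proof.
move=> c0; elim: k => [|k IH] h; first by rewrite expr0 mul1r addn0.
rewrite exprS addnS -mulrA; apply: le_trans (h _ (ltnSn k)).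
by apply: ler_wpM2l => //; apply: IH => j jk; apply: h; rewrite ltnW.
Qed.

Lemma ratio_prod_le b c n k : 0 <= c ->
  (forall j, (j < k)%N -> b (n + j).+1 <= c * b (n + j)%N) ->
  b (n + k)%N <= c ^+ k * b n.
Proof.
move=> c0; elim: k => [|k IH] h; first by rewrite expr0 mul1r addn0.
rewrite exprS addnS -mulrA; apply: le_trans (h _ (ltnSn k)) _.
by apply: ler_wpM2l => //; apply: IH => j jk; apply: h; rewrite ltnW.
Qed.

End Sequences.

Section RatioLimit.
Context {R : realType}.
Implicit Types (b : nat -> R) (mu D : R) (N : nat).

Lemma root_lim_gt0 b mu : (forall n, 0 <= b n) -> 0 < mu ->
  (fun n => b n `^ n%:R^-1) @ \oo --> mu ->
  exists N, forall n, (N <= n)%N -> 0 < b n.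
Proof.
move=> b_ge0 mu_gt0 root_lim; have t1 : 1 < 2 :> R by lra.
have [N hN] := root_lim_bounds b_ge0 mu_gt0 t1 root_lim.
exists N => n /hN /andP[h _]; apply: lt_le_trans h.
by rewrite exprn_gt0 // divr_gt0.
Qed.

(** The hypothesis bounds a product of ratios; dividing by the first one costs
    a factor at most [2 / mu] when this ratio is at least [mu / 2]. *)
Lemma ratio_drop b mu D N1 : (forall n, 0 <= b n) -> 0 < mu -> 0 < D ->
  (fun n => b n `^ n%:R^-1) @ \oo --> mu ->
  (forall n, (N1 <= n)%N -> (b n.+1 / b n) ^+ 2 - D / n%:R
     <= b n.+1 / b n * (b n.+2 / b n.+1)) ->
  let phi n := b n.+1 / b n in
  exists N, forall n, (N <= n)%N -> 0 < b n /\
    (mu / 2 <= phi n -> phi n - 2 * D / mu / n%:R <= phi n.+1).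
Proof.
move=> b_ge0 mu_gt0 D_gt0 root_lim phi_step phi.
have [N2 hN2] := root_lim_gt0 b_ge0 mu_gt0 root_lim.
exists (maxn 1 (maxn N1 N2)) => n; rewrite !geq_max => /and3P[n1 nN1 nN2].
split=> [|h]; first exact: hN2.
have p0 : 0 < phi n by apply: lt_le_trans h; rewrite divr_gt0.
have n0 : 0 < n%:R :> R by rewrite ltr0n.
rewrite -(ler_pM2l p0); move: (phi_step _ nN1); apply: le_trans.
rewrite mulrBr -expr2 lerD2l lerN2 mulrA ler_pM2r ?invr_gt0 //.
rewrite mulrA ler_pdivlMr //; move: (phi n) h => p h; nra.
Qed.

Lemma ratio_le_eventually b mu D N1 e :
  (forall n, 0 <= b n) -> 0 < mu -> 0 < D ->
  (fun n => b n `^ n%:R^-1) @ \oo --> mu ->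
  (forall n, (N1 <= n)%N -> (b n.+1 / b n) ^+ 2 - D / n%:R
     <= b n.+1 / b n * (b n.+2 / b n.+1)) ->
  0 < e -> exists N, forall n, (N <= n)%N -> b n.+1 / b n < mu + e.
Proof.
move=> b_ge0 mu_gt0 D_gt0 root_lim phi_step e0; set D1 := 2 * D / mu.
have D10 : 0 < D1 by rewrite divr_gt0 // mulr_gt0.
have [M M0 hM] : exists2 M, (0 < M)%N & 2 * D1 / e <= M%:R.
  exists (Num.bound (2 * D1 / e)).+1 => //.
  apply: ltW; apply: lt_trans (archi_boundP _) _; last by rewrite ltr_nat.
  by rewrite divr_ge0 // ltW // mulr_gt0.
have q1 : 1 < 1 + e / 2 / mu by rewrite ltrDl !divr_gt0.
have [t t1 ht] := root_gap q1 M0.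
pose phi n : R := b n.+1 / b n.
have [N2 hN2] : exists N, forall n, (N <= n)%N -> 0 < b n /\
    (mu / 2 <= phi n -> phi n - D1 / n%:R <= phi n.+1).
  exact: ratio_drop root_lim phi_step.
have [N3 hN3] := root_lim_bounds b_ge0 mu_gt0 t1 root_lim.
exists (maxn 1 (maxn M (maxn N2 N3))) => n; rewrite !geq_max => /and4P[n1 nM nN2 nN3].
(* a ratio of [mu + e] at [n] stays above [mu + e / 2] for [n %/ M] steps *)
rewrite -/(phi n) ltNge; apply/negP => hphi.
have := ht _ nM; have kn : (n %/ M * M <= n)%N by exact: leq_trunc_div.
have : (n %/ M <= n)%N by exact: leq_div.
move: (n %/ M)%N kn => k kn k_le_n tk.
have n0 : 0 < n%:R :> R by rewrite ltr0n.
have kD j : (j <= k)%N -> j%:R * (D1 / n%:R) <= e / 2.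
  move=> jk; rewrite mulrA ler_pdivrMr //.
  have jM : j%:R * M%:R <= n%:R :> R.
    by rewrite -natrM ler_nat; apply: leq_trans kn; rewrite leq_mul2r jk orbT.
  have : j%:R * (2 * D1 / e) <= n%:R by apply: le_trans jM; apply: ler_wpM2l.
  rewrite mulrA ler_pdivrMr //; lra.
have main j : (j <= k)%N -> mu + e - j%:R * (D1 / n%:R) <= phi (n + j)%N.
  elim: j => [|j IH] jk; first by rewrite mul0r subr0 addn0.
  have h1 := IH (ltnW jk); have h2 := kD _ (ltnW jk).
  have [_ hd] := hN2 (n + j)%N (leq_trans nN2 (leq_addr _ _)).
  rewrite addnS; apply: le_trans (hd _); last by lra.
  have : D1 / (n + j)%:R <= D1 / n%:R.
    by rewrite ler_pM2l // lef_pV2 ?posrE ?ltr0n ?addn_gt0 ?n1 // ler_nat leq_addr.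
  by rewrite -natr1 mulrDl mul1r; lra.
have prod : (mu + e / 2) ^+ k * b n <= b (n + k)%N.
  apply: ratio_prod_ge => [|j jk]; first by lra.
  have [bp _] := hN2 (n + j)%N (leq_trans nN2 (leq_addr _ _)).
  rewrite -ler_pdivlMr //; apply: le_trans (main _ (ltnW jk)).
  by have := kD _ (ltnW jk); lra.
have /andP[lo _] := hN3 n nN3.
have /andP[_ hi] := hN3 (n + k)%N (leq_trans nN3 (leq_addr _ _)).
have t0 : 0 < t by lra.
have : (mu + e / 2) ^+ k * (mu / t) ^+ n <= (mu * t) ^+ (n + k).
  apply: le_trans hi; apply: le_trans prod.
  by apply: ler_wpM2l => //; apply: exprn_ge0; lra.
have -> : mu + e / 2 = mu * (1 + e / 2 / mu) by field; lra.
set q := 1 + _ in q1 tk *.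
rewrite !exprMn exprVn exprD !mulrA ler_pdivrMr ?exprn_gt0 //.
rewrite [_ * mu ^+ n]mulrC !mulrA -!mulrA !ler_pM2l ?exprn_gt0 //.
move=> hq; move: tk; rewrite leNgt => /negP; apply.
by apply: le_lt_trans hq _; rewrite -!exprD ltr_eXn2l //; clear -k_le_n n1; lia.
Qed.

Lemma ratio_ge_eventually b mu D N1 e :
  (forall n, 0 <= b n) -> 0 < mu -> 0 < D ->
  (fun n => b n `^ n%:R^-1) @ \oo --> mu ->
  (forall n, (N1 <= n)%N -> (b n.+1 / b n) ^+ 2 - D / n%:R
     <= b n.+1 / b n * (b n.+2 / b n.+1)) ->
  0 < e -> e <= mu / 2 -> exists N, forall n, (N <= n)%N -> mu - e < b n.+1 / b n.
Proof.
move=> b_ge0 mu_gt0 D_gt0 root_lim phi_step e0 emu; set D1 := 2 * D / mu.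
have D10 : 0 < D1 by rewrite divr_gt0 // mulr_gt0.
have [M M1 hM] : exists2 M, (1 < M)%N & 4 * D1 / e <= M%:R.
  exists (Num.bound (4 * D1 / e)).+2 => //.
  apply: ltW; apply: lt_trans (archi_boundP _) _; last by rewrite ltr_nat ltnW.
  by rewrite divr_ge0 // ltW // mulr_gt0.
have q1 : 1 < mu / (mu - e / 2) by rewrite ltr_pdivlMr ?mul1r; lra.
have [t t1 ht] := root_gap q1 (ltnW M1).
pose phi n : R := b n.+1 / b n.
have [N2 hN2] : exists N, forall n, (N <= n)%N -> 0 < b n /\
    (mu / 2 <= phi n -> phi n - D1 / n%:R <= phi n.+1).
  exact: ratio_drop root_lim phi_step.
have [N3 hN3] := root_lim_bounds b_ge0 mu_gt0 t1 root_lim.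
exists (maxn 2 (maxn M (maxn N2.*2 N3.*2))) => n; rewrite !geq_max => /and4P[n1 nM nN2 nN3].
(* backwards from [n], the ratios stay below [mu - e / 2] for [n %/ M] steps:
   each of them either is below [mu / 2] or exceeds the next one only slightly *)
rewrite -/(phi n) ltNge; apply/negP => hphi.
have := ht _ nM; have kn : (n %/ M * M <= n)%N by exact: leq_trunc_div.
move: (n %/ M)%N kn => k kn tk.
have n0 : 0 < n%:R :> R by rewrite ltr0n ltnW.
have k2 : (k * 2 <= n)%N by apply: leq_trans kn; rewrite leq_mul2l M1 orbT.
have kD j : (j <= k)%N -> j%:R * (2 * D1 / n%:R) <= e / 2.
  move=> jk; rewrite mulrA ler_pdivrMr //.
  have jM : j%:R * M%:R <= n%:R :> R.
    by rewrite -natrM ler_nat; apply: leq_trans kn; rewrite leq_mul2r jk orbT.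
  have : j%:R * (4 * D1 / e) <= n%:R by apply: le_trans jM; apply: ler_wpM2l.
  rewrite mulrA ler_pdivrMr //; lra.
have main j : (j <= k)%N -> phi (n - j)%N <= mu - e + j%:R * (2 * D1 / n%:R).
  elim: j => [|j IH] jk; first by rewrite mul0r addr0 subn0.
  have h1 := IH (ltnW jk).
  have mN : (N2 <= n - j.+1)%N by clear -jk k2 nN2; lia.
  have [_ hd] := hN2 _ mN.
  have e1 : (n - j.+1).+1 = (n - j)%N by clear -jk k2; lia.
  have jr : 0 <= j%:R :> R by [].
  have Dn : 0 < 2 * D1 / n%:R by rewrite divr_gt0 // mulr_gt0.
  rewrite -natr1 mulrDl mul1r; have [hm|hm] := lerP (mu / 2) (phi (n - j.+1)%N); last first.
    have := mulr_ge0 jr (ltW Dn); lra.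
  have := hd hm; rewrite e1.
  have : D1 / (n - j.+1)%:R <= 2 * D1 / n%:R.
    have mn0 : (0 < n - j.+1)%N by clear -jk k2 n1; lia.
    rewrite ler_pdivrMr ?ltr0n //.
    have nm : n%:R <= 2 * (n - j.+1)%:R :> R.
      by rewrite -natrM ler_nat; clear -jk k2 n1; lia.
    by rewrite [leRHS]mulrAC ler_pdivlMr //; have := ler_wpM2l (ltW D10) nm; lra.
  lra.
have prod : b (n - k + k)%N <= (mu - e / 2) ^+ k * b (n - k)%N.
  apply: ratio_prod_le => [|j jk]; first by lra.
  have jN : (N2 <= n - k + j)%N by clear -jk k2 nN2; lia.
  have [bp _] := hN2 _ jN.
  rewrite -ler_pdivrMr //; have ej : (n - k + j = n - (k - j))%N by clear -jk k2; lia.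
  have kj : (k - j <= k)%N by exact: leq_subr.
  have := main _ kj; rewrite -ej /phi; have := kD _ kj; lra.
have k_le_n : (k <= n)%N by clear -k2; lia.
rewrite subnK // in prod.
have n3 : (N3 <= n)%N by clear -nN3; lia.
have n3k : (N3 <= n - k)%N by clear -nN3 k2; lia.
have /andP[lo _] := hN3 n n3.
have /andP[_ hi] := hN3 _ n3k.
have t0 : 0 < t by lra.
have q0 : 0 < mu / (mu - e / 2) by lra.
have me : mu - e / 2 = mu / (mu / (mu - e / 2)).
  by field; apply/andP; split; lra.
have : (mu / t) ^+ n <= (mu - e / 2) ^+ k * (mu * t) ^+ (n - k).
  apply: le_trans lo _; apply: le_trans prod _.
  by apply: ler_wpM2l => //; apply: exprn_ge0; lra.
rewrite me; move: (mu / (mu - _)) q0 q1 tk => q q0 q1 tk.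
have -> : (mu / t) ^+ n = mu ^+ k * (mu ^+ (n - k) / t ^+ n).
  by rewrite exprMn exprVn mulrA -exprD subnKC.
have -> : (mu / q) ^+ k * (mu * t) ^+ (n - k) =
    mu ^+ k * (mu ^+ (n - k) * (t ^+ (n - k) / q ^+ k)).
  by rewrite !exprMn exprVn mulrACA [_^-1 * _]mulrC -!mulrA.
rewrite !ler_pM2l ?exprn_gt0 // -[leLHS]mul1r ler_pdivrMr ?exprn_gt0 //.
rewrite mulrAC -exprD ler_pdivlMr ?exprn_gt0 // mul1r.
move=> hq; move: tk; rewrite leNgt => /negP; apply.
apply: le_lt_trans hq _; rewrite ltr_eXn2l //; clear -n1 k_le_n; lia.
Qed.

(** A ratio above [mu + e] at [n] persists up to [n + c * n], and one below
    [mu - e] must have persisted since [n - c * n]; either way [b] gains or loses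
    an exponential factor, which the limit of the roots excludes. *)
Lemma ratio_limit b mu D N1 :
  (forall n, 0 <= b n) -> 0 < mu -> 0 < D ->
  (fun n => b n `^ n%:R^-1) @ \oo --> mu ->
  (forall n, (N1 <= n)%N -> (b n.+1 / b n) ^+ 2 - D / n%:R
     <= b n.+1 / b n * (b n.+2 / b n.+1)) ->
  (fun n => b n.+1 / b n) @ \oo --> mu.
Proof.
move=> b0 mu0 D0 root step; apply/cvg_seqP => e e0.
have [N hN] := ratio_le_eventually b0 mu0 D0 root step e0.
pose e' : R := Num.min e (mu / 2).
have e'0 : 0 < e' by rewrite lt_min e0 divr_gt0.
have e'mu : e' <= mu / 2 by rewrite ge_min lexx orbT.
have [N' hN'] := ratio_ge_eventually b0 mu0 D0 root step e'0 e'mu.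
exists (maxn N N') => n; rewrite geq_max => /andP[/hN h /hN' h'].
have e'e : e' <= e by rewrite ge_min lexx.
by rewrite ler_distl; apply/andP; split; lra.
Qed.

(** The tails inherit the ratio because [A n.+1 - mu * A n] is the sum of the
    [a k * (a k.+1 / a k - mu)] over [k >= n]. *)
Lemma tail_ratio_limit (a A : nat -> R) (mu : R) :
  (forall n, 0 <= A n) -> (forall n, A n = a n + A n.+1) ->
  A @ \oo --> (0 : R) -> (exists N, forall n, (N <= n)%N -> 0 < a n) ->
  (fun n => a n.+1 / a n) @ \oo --> mu ->
  (fun n => A n.+1 / A n) @ \oo --> mu.
Proof.
move=> A0 aA Alim [N1 a0] /cvg_seqP ratio; apply/cvg_seqP => e e0.
have [N2 h] := ratio e e0; exists (maxn N1 N2) => n; rewrite geq_max => /andP[n1 n2].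
have An : 0 < A n by have := a0 n n1; have := A0 n.+1; rewrite (aA n); lra.
suff : `|mu * A n - A n.+1| <= e * A n.
  rewrite -[X in _ <= _ * X -> _](gtr0_norm An) -ler_pdivrMr ?normr_gt0 ?gt_eqF //.
  by rewrite -normf_div mulrBl mulfK // gt_eqF.
have fin k : `|mu * (A n - A (n + k)%N) - (A n.+1 - A (n + k).+1)| <= e * (A n - A (n + k)%N).
  elim: k => [|k IH]; first by rewrite addn0 !subrr !mulr0 subr0 normr0.
  have ak : 0 < a (n + k)%N by apply: a0; apply: leq_trans n1 (leq_addr _ _).
  have : `|mu * a (n + k)%N - a (n + k).+1| <= e * a (n + k)%N.
    have := h (n + k)%N (leq_trans n2 (leq_addr _ _)).
    rewrite -(ler_pM2r ak) -[X in `|_| * X](gtr0_norm ak) -normrM mulrBl mulfVK //.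
    by rewrite gt_eqF.
  have := aA (n + k).+1; rewrite addnS.
  move: IH; rewrite (aA (n + k)%N) !ler_norml => /andP[? ?] ? /andP[? ?].
  by apply/andP; split; lra.
apply/ler_addgt0Pr => r r0.
have c0 : 0 < 1 + `|mu| + e + 1 by have := normr_ge0 mu; lra.
have [N3 h3] := (cvg_seqP _ _).1 Alim _ (divr_gt0 r0 c0).
have := fin N3; have hA := h3 (n + N3)%N (leq_addl _ _).
have hA' := h3 (n + N3).+1 (leqW (leq_addl _ _)).
rewrite !sub0r !normrN !(ger0_norm (A0 _)) in hA hA'.
set x := A (n + N3)%N in hA *; set y := A _.+1 in hA' *.
have x0 : 0 <= x by exact: A0.
have y0 : 0 <= y by exact: A0.
have : `|mu| * x <= `|mu| * (r / (1 + `|mu| + e + 1)) by exact: (ler_wpM2l (normr_ge0 mu) hA).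
have : - (`|mu| * x) <= mu * x <= `|mu| * x.
  by rewrite -ler_norml normrM (ger0_norm x0).
have : (1 + `|mu| + e + 1) * (r / (1 + `|mu| + e + 1)) = r by rewrite mulrC divfK // gt_eqF.
set s := r / _ in hA hA' *; have ex : 0 <= e * x by rewrite mulr_ge0 // ltW.
have es : 0 <= e * s by rewrite mulr_ge0 ?divr_ge0 // ltW.
have s0 : 0 <= s by rewrite divr_ge0 // ltW.
rewrite !ler_norml => hr /andP[? ?] ? /andP[? ?].
apply/andP; split; lra.
Qed.

End RatioLimit.

(** * Lattice geometry *)


Section Geometry.
Context {d : nat}.
Notation site := 'rV[int]_d.
Implicit Types (Q : pred site) (x y z v : site) (A B S : {fset site}).

Lemma site_ext x y : (forall i, x ord0 i = y ord0 i) -> x = y.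
Proof. by move=> h; apply/rowP => i; exact: h. Qed.

Lemma neighbor_sym x y : neighbor x y = neighbor y x.
Proof. by rewrite /neighbor; under eq_bigr do rewrite distrC. Qed.

Lemma neighborDr x y a : neighbor (x + a) (y + a) = neighbor x y.
Proof.
by rewrite /neighbor; under eq_bigr do rewrite !mxE opprD addrACA subrr addr0.
Qed.

Lemma neighbor_irr x : ~~ neighbor x x.
Proof.
by rewrite /neighbor; under eq_bigr do rewrite subrr normr0; rewrite big1.
Qed.

Lemma neighbor_neq x y : neighbor x y -> x != y.
Proof. by apply: contraTneq => ->; exact: neighbor_irr. Qed.

Lemma neighbor_coord x y i : neighbor x y -> `|y ord0 i - x ord0 i| <= 1.
Proof.
rewrite /neighbor => /eqP e; rewrite -[leRHS]e (bigD1 i)//= lerDl.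
exact: sumr_ge0.
Qed.

Definition unit_step (s : bool) (i : 'I_d) : site := (-1) ^+ s *: delta_mx ord0 i.

Lemma unit_stepE s i j : unit_step s i ord0 j = (-1) ^+ s *+ (j == i).
Proof. by rewrite !mxE eqxx /= mulr_natr. Qed.

Lemma neighbor_step x s i : neighbor x (x + unit_step s i).
Proof.
rewrite /neighbor (bigD1 i)//= big1 => [|j /negPf ji].
  by rewrite mxE unit_stepE eqxx addr0 addrAC subrr add0r normrX normrN1 expr1n.
by rewrite mxE unit_stepE ji addr0 subrr normr0.
Qed.

Lemma neighborP x y : neighbor x y -> exists s i, y = x + unit_step s i.
Proof.
move=> xy; have [i xyi] : exists i, y ord0 i != x ord0 i.
  apply/existsP; apply: contraLR xy; rewrite negb_exists => /forallP h.
  suff -> : y = x by exact: neighbor_irr.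
  by apply: site_ext => i; have := h i; rewrite negbK => /eqP.
move: (xy); rewrite /neighbor (bigD1 i)//= => /eqP.
set r := \sum_(_ | _) _ => e.
have r0 : 0 <= r by apply: sumr_ge0.
have n1 : 1 <= `|y ord0 i - x ord0 i| by move: xyi; lia.
have rE : r = 0 by lia.
have {}e : `|y ord0 i - x ord0 i| = 1 by lia.
exists (y ord0 i < x ord0 i), i; apply: site_ext => j; rewrite mxE unit_stepE.
have [->|ji] := eqVneq j i.
  rewrite mulr1n; case: ltP e => h.
    by rewrite ltr0_norm ?subr_lt0// opprB expr1 => /eqP;
      rewrite subr_eq => /eqP ->; rewrite addrAC subrr add0r.
  by rewrite ger0_norm ?subr_ge0// expr0 => <-; rewrite addrC subrK.
move/eqP: rE; rewrite psumr_eq0 // => /allP /(_ j (mem_index_enum _)).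
by rewrite ji /= normr_eq0 subr_eq0 addr0 => /eqP.
Qed.

Definition box (r : nat) : {fset site} :=
  let shift (v : 'rV['I_(r.*2.+1)]_d) : site := \row_i ((v ord0 i : nat)%:Z - r%:Z) in
  [fset shift v | v : 'rV['I_(r.*2.+1)]_d]%fset.

Definition cube (r : nat) x : {fset site} := [fset (x + v)%R | v in box r]%fset.

Lemma in_box r (v : site) : (v \in box r) = [forall i, `|v ord0 i| <= r%:Z].
Proof.
apply/imfsetP/forallP => /= [[u _ ->] i|h].
  by rewrite mxE; have := ltn_ord (u ord0 i); lia.
exists (\row_i inord (absz (v ord0 i + r%:Z))) => //.
by apply: site_ext => i; rewrite !mxE inordK; have := h i; lia.
Qed.

Lemma in_cube r x y : (y \in cube r x) = [forall i, `|y ord0 i - x ord0 i| <= r%:Z].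
Proof.
apply/imfsetP/forallP => /= [[v vb ->] i|h].
  by rewrite mxE addrAC subrr add0r; move: vb; rewrite in_box => /forallP.
exists (y - x); last by rewrite addrC subrK.
by rewrite in_box; apply/forallP => i; rewrite !mxE.
Qed.

Lemma card_cube r x : (#|` cube r x| <= #|` box r|)%N.
Proof. exact: leq_imfset_card. Qed.

Lemma cube_refl r x : x \in cube r x.
Proof. by rewrite in_cube; apply/forallP => i; rewrite subrr normr0. Qed.

Lemma cube_sym r x y : (x \in cube r y) = (y \in cube r x).
Proof. by rewrite !in_cube; under eq_forallb do rewrite distrC. Qed.

Lemma cube_trans r s x y z : y \in cube r x -> z \in cube s y -> z \in cube (r + s) x.
Proof.
rewrite !in_cube => /forallP h1 /forallP h2; apply/forallP => i.
by have := h1 i; have := h2 i; lia.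
Qed.

Lemma neighbor_cube x y : neighbor x y -> y \in cube 1 x.
Proof. by move=> xy; rewrite in_cube; apply/forallP => i; exact: neighbor_coord. Qed.

(** ** Connection *)

(** The shape follows that of the clusters, so that a cluster is the set of
    sites linked to its base point. *)
Definition linked (Q : pred site) x y : Prop :=
  exists p : seq site, [/\ path (@neighbor d) x p, last x p = y & all Q (x :: p)].

Lemma linked_refl Q x : Q x -> linked Q x x.
Proof. by move=> Qx; exists [::]; rewrite /= Qx. Qed.

Lemma linked_trans Q y x z : linked Q x y -> linked Q y z -> linked Q x z.
Proof.
move=> [p [pp lp ap]] [r [pr lr ar]]; exists (p ++ r); split.
- by rewrite cat_path pp lp.
- by rewrite last_cat lp.
- by rewrite -cat_cons all_cat ap; move: ar => /= /andP[].
Qed.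

Lemma linked_step Q x y : Q x -> Q y -> neighbor x y -> linked Q x y.
Proof. by move=> Qx Qy xy; exists [:: y]; rewrite /= Qx Qy xy. Qed.

Lemma linked_sym Q x y : linked Q x y -> linked Q y x.
Proof.
move=> [p [pp lp ap]]; exists (rev (belast x p)); split.
- rewrite -lp rev_path; under eq_path do rewrite neighbor_sym; done.
- by case: p {pp ap} lp => [<-//|a p] _ /=; rewrite rev_cons last_rcons.
- have /perm_all -> // : perm_eq (y :: rev (belast x p)) (x :: p).
  by rewrite [in X in perm_eq _ X]lastI lp -rev_rcons perm_rev.
Qed.

Lemma linked_sub (Q Q' : pred site) x y :
  {in Q, forall z, Q' z} -> linked Q x y -> linked Q' x y.
Proof.
move=> QQ' [p [pp lp ap]]; exists p; split => //.
by apply/allP => z /(allP ap); exact: QQ'.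
Qed.

Lemma linked_last (Q : pred site) x y : linked Q x y -> Q y.
Proof. by move=> [p [_ <- /allP]]; apply; exact: mem_last. Qed.

Definition path_connected A : Prop := {in A &, forall x y, linked (mem A) x y}.

Lemma connected_from x A :
  {in A, forall y, linked (mem A) x y} -> path_connected A.
Proof.
by move=> h y z yA zA; exact: linked_trans (linked_sym (h _ yA)) (h _ zA).
Qed.

Definition closure1 A : {fset site} :=
  (\bigcup_(x <- A) [fset y in cube 1 x | (x == y) || neighbor x y])%fset.

Lemma closure1P A y :
  reflect (exists2 x, x \in A & (x == y) || neighbor x y) (y \in closure1 A).
Proof.
rewrite /closure1; apply: (iffP (bigfcupP _ _ _ _)) => [[x /andP[xA _]]|[x xA xy]].
  by rewrite !inE /= => /andP[_ xy]; exists x.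
exists x; first by rewrite xA.
rewrite !inE /= xy andbT; case/predU1P: xy => [<-|]; first exact: cube_refl.
exact: neighbor_cube.
Qed.

Lemma sub_closure1 A x : x \in A -> x \in closure1 A.
Proof. by move=> xA; apply/closure1P; exists x; rewrite ?eqxx. Qed.

Lemma closure1_neighbor A x y : x \in A -> neighbor x y -> y \in closure1 A.
Proof. by move=> xA xy; apply/closure1P; exists x; rewrite ?xy ?orbT. Qed.

Lemma path_stays Q A x p : {in A, forall y z, neighbor y z -> Q z -> z \in A} ->
  x \in A -> path (@neighbor d) x p -> all Q p -> all (mem A) (x :: p).
Proof.
move=> h; elim: p x => [|y p IH] x xA /=; first by rewrite xA.
move=> /andP[xy pp] /andP[Qy ap]; rewrite xA /=.
by apply: IH => //; exact: h xy Qy.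
Qed.

(** A path of occupied sites that leaves [A] visits an outer neighbour of [A],
    which is vacant; conversely an occupied outer neighbour of [A] would belong
    to the cluster. *)
Lemma cluster_eqP Q A x : x \in A -> path_connected A ->
  [set y | linked Q x y] = [set` A] <-> {in closure1 A, forall y, Q y = (y \in A)}.
Proof.
move=> xA cA; split=> [e y /closure1P[z zA zy]|h].
  have zL : linked Q x z by have : [set` A] z by []; rewrite -e.
  have Qz := linked_last zL.
  apply/idP/idP => [Qy|yA].
    suff : [set` A] y by [].
    rewrite -e /=; case/predU1P: zy => [<-//|zy].
    by apply: linked_trans zL _; exact: linked_step.
  have : [set` A] y by [].
  by rewrite -e => /linked_last.
apply/seteqP; split=> y /=.
  move=> [p [pp <- ap]].
  have /allP : all (mem A) (x :: p).
    apply: (path_stays (Q := Q)) => //; last by case/andP: ap.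
    by move=> u uA v uv; rewrite h //; exact: closure1_neighbor uv.
  by apply; exact: mem_last.
move=> yA; apply: linked_sub (cA _ _ xA yA) => z zA.
by rewrite h //; exact: sub_closure1.
Qed.

Lemma cluster_connected Q A x : Q x -> [set y | linked Q x y] = [set` A] ->
  x \in A /\ path_connected A.
Proof.
move=> Qx e; have LA y : linked Q x y -> y \in A.
  by move=> h; have : [set y | linked Q x y] y by []; rewrite e.
have xA : x \in A by apply: LA; exact: linked_refl.
split=> //; apply: (@connected_from x) => y yA.
have : [set` A] y by [].
rewrite -e => -[p [pp lp ap]]; exists p; split=> //.
apply: (path_stays (Q := Q)) => //; last by case/andP: ap.
move=> u uA v uv Qv; apply: LA; apply: (@linked_trans _ u).
  by have : [set` A] u by []; rewrite -e.
apply: linked_step => //.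
by have : [set` A] u by []; rewrite -e => /linked_last.
Qed.

(** ** Animals *)

Definition animal n A : bool := [&& #|` A|%fset == n, 0 \in A & `[<path_connected A>]].

Lemma path_cube x p : path (@neighbor d) x p -> last x p \in cube (size p) x.
Proof.
elim: p x => [|y p IH] x /=; first by rewrite cube_refl.
move=> /andP[xy /IH]; apply: (@cube_trans 1).
exact: neighbor_cube.
Qed.

Lemma cube0E r : cube r (0 : site) = box r.
Proof. by apply/fsetP => y; rewrite in_cube in_box; under eq_forallb do rewrite mxE subr0. Qed.

Lemma animal_box n A : animal n A -> (A `<=` box n)%fset.
Proof.
move=> /and3P[/eqP cA A0 /asboolP connA]; apply/fsubsetP => y yA.
have [p [pp <- ap]] := connA _ _ A0 yA.
case/shortenP: pp => p' pp' up' sub.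
rewrite -cube0E; have := path_cube pp'; rewrite !in_cube.
have : (size p' < n)%N.
  rewrite -cA; apply: (uniq_leq_size up') => z; rewrite inE => /predU1P[->//|zp0]; have zp := sub _ zp0.
  by move/allP: ap; apply; rewrite inE zp orbT.
move=> lt /forallP h; apply/forallP => i; apply: le_trans (h i) _.
by rewrite lez_nat ltnW.
Qed.

Definition animals n : {fset {fset site}} :=
  [fset A in fpowerset (box n) | animal n A]%fset.

Lemma in_animals n A : (A \in animals n) = animal n A.
Proof.
rewrite !inE /= andb_idl // fpowersetE; exact: animal_box.
Qed.

(** ** Full cubes and punctured cubes *)

(** Excluding the origin from the full cubes keeps the marked site [0] in the
    animal when the centre of a cube is removed. *)
Definition full A : {fset site} :=
  [fset x in A | (x != 0) && (cube 1 x `<=` A)]%fset.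

(** The neighbours of a hole belong to [A], hence the finite range
    [closure1 A]. *)
Definition holes A : {fset site} :=
  [fset x in closure1 A | (x \notin A) && (cube 1 x `\ x `<=` A)]%fset.

Lemma in_full A x : (x \in full A) = (x != 0) && (cube 1 x `<=` A)%fset.
Proof.
rewrite !inE /= andb_idl // => /andP[_ /fsubsetP]; apply; exact: cube_refl.
Qed.

Lemma cubeD1 x A : x \notin A ->
  (cube 1 x `<=` x |` A)%fset = (cube 1 x `\ x `<=` A)%fset.
Proof.
move=> xA; apply/fsubsetP/fsubsetP => h y.
  by rewrite !inE => /andP[/negPf yx /h]; rewrite !inE yx.
move=> yc; rewrite !inE; have [//|yx] := eqVneq y x.
by apply: h; rewrite !inE yx.
Qed.

Lemma connectedU A B x : path_connected A -> path_connected B -> x \in A -> x \in B ->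
  path_connected (A `|` B)%fset.
Proof.
move=> cA cB xA xB; apply: (@connected_from x) => y; rewrite inE => /orP[] h.
  by apply: linked_sub (cA _ _ xA h) => z; rewrite !inE => ->.
by apply: linked_sub (cB _ _ xB h) => z; rewrite !inE => ->; rewrite orbT.
Qed.

Lemma int_step_toward (a b : int) :
  `|a - b| <= 1 -> a != b -> a + (-1) ^+ (b < a)%R = b.
Proof.
by move=> h ab; case: (boolP (b < a)) => ba; rewrite ?expr1 ?expr0; lia.
Qed.

(** Changing one differing coordinate at a time joins a site of a unit cube to
    its centre inside the cube. *)
Lemma connected_cube1 x : path_connected (cube 1 x).
Proof.
suff h (y : site) : y \in cube 1 x -> linked (mem (cube 1 x)) y x.
  by apply: (@connected_from x) => y /h /linked_sym.
have [n] := ubnP #|[pred i | y ord0 i != x ord0 i]|; elim: n y => // n IH y yn yc.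
have [/existsP[i yi]|/existsPn h] := boolP [exists i, y ord0 i != x ord0 i]; last first.
  have -> : y = x by apply: site_ext => i; have := h i; rewrite negbK => /eqP.
  by apply: linked_refl; exact: cube_refl.
pose s := x ord0 i < y ord0 i.
have zi : (y + unit_step s i) ord0 i = x ord0 i.
  move: yc; rewrite in_cube => /forallP /(_ i); rewrite mxE unit_stepE eqxx mulr1n.
  move=> h; exact: int_step_toward.
have zj j : j != i -> (y + unit_step s i) ord0 j = y ord0 j.
  by move=> /negPf ji; rewrite mxE unit_stepE ji addr0.
have zc : y + unit_step s i \in cube 1 x.
  move: yc; rewrite !in_cube => /forallP h; apply/forallP => j.
  by have [->|ji] := eqVneq j i; rewrite ?zi ?subrr ?normr0 // zj.
apply: (linked_trans (linked_step yc zc (neighbor_step _ _ _))).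
apply: IH zc; rewrite -ltnS; apply: leq_trans yn; rewrite ltnS.
apply: proper_card; apply/properP; split; last by exists i; rewrite !inE ?zi ?eqxx.
apply/fintype.subsetP => j; rewrite !inE.
by have [->|ji] := eqVneq j i; rewrite ?zi ?eqxx // zj.
Qed.

Lemma animal_insert n A x : animal n A -> x \in A ->
  animal #|` (A `|` cube 1 x)%fset| (A `|` cube 1 x)%fset.
Proof.
move=> /and3P[_ A0 /asboolP connA] xA.
rewrite /animal eqxx !inE A0 /=; apply/asboolP.
by apply: connectedU (cube_refl 1 x) => //; exact: connected_cube1.
Qed.

Lemma cubeD1_step x s i : x + unit_step s i \in (cube 1 x `\ x)%fset.
Proof.
have xn := neighbor_step x s i.
by rewrite !inE eq_sym neighbor_neq //= neighbor_cube.
Qed.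

(** The corner [x + unit_step s i + unit_step t j] joins the two neighbours of
    [x] and avoids [x]. *)
Lemma linked_corner x s t i j : i != j ->
  linked (mem (cube 1 x `\ x)%fset) (x + unit_step s i) (x + unit_step t j).
Proof.
move=> ij; set c := x + unit_step s i + unit_step t j.
have cC : c \in (cube 1 x `\ x)%fset.
  rewrite !inE; apply/andP; split.
    apply/negP => /eqP /rowP /(_ i).
    rewrite /c !mxE !eqxx (negPf ij) /= mulr1 mulr0 addr0 => /eqP.
    by rewrite -[X in _ == X]addr0 (inj_eq (addrI _)) signr_eq0.
  rewrite in_cube; apply/forallP => k; rewrite 2!mxE !unit_stepE -addrA addrAC subrr add0r.
  have [->|ki] := eqVneq k i; first by rewrite (negPf ij) addr0 mulr1n normrX normrN1 expr1n.
  by rewrite add0r; case: eqP => _; rewrite ?normr0 // mulr1n normrX normrN1 expr1n.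
apply: (@linked_trans _ c).
  by apply: linked_step; [exact: cubeD1_step|exact: cC|exact: neighbor_step].
apply: linked_step; [exact: cC|exact: cubeD1_step|].
by rewrite neighbor_sym /c addrAC neighbor_step.
Qed.

Context (d_ge2 : (2 <= d)%N).

Lemma other_axis (i : 'I_d) : exists j, i != j.
Proof.
have d_gt0 : (0 < d)%N by lia.
have [/eqP i0|i0] := boolP (i == 0%N :> nat).
  by exists (Ordinal d_ge2); apply/eqP => e; move: i0; rewrite e.
by exists (Ordinal d_gt0); apply: contra i0 => /eqP ->.
Qed.

(** Opposite neighbours of [x] are joined by way of a second axis, which is
    where the dimension matters. *)
Lemma linked_around x y z : neighbor x y -> neighbor x z ->
  linked (mem (cube 1 x `\ x)%fset) y z.
Proof.
move=> /neighborP[s [i ->]] /neighborP[t [j ->]].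
have [<-|ij] := eqVneq i j; last exact: linked_corner.
have [k ik] := other_axis i.
apply: (@linked_trans _ (x + unit_step true k)); first exact: linked_corner.
by apply: linked_corner; rewrite eq_sym.
Qed.

(** A path through the centre of a full cube can be rerouted inside the cube. *)
Lemma connectedD1 A x : path_connected A -> (cube 1 x `<=` A)%fset ->
  path_connected (A `\ x)%fset.
Proof.
move=> cA /fsubsetP sub y z; rewrite !inE => /andP[yx yA] /andP[zx zA].
have [p [pp lp ap]] := cA _ _ yA zA; move: zx; rewrite -lp => {lp zA z}.
(* the second half covers the paths that start at the centre: they may be
   entered from any of its neighbours *)
suff [h _] : let R := linked (mem (A `\ x)%fset) in
    (last y p != x -> y != x -> R y (last y p)) /\
    (last y p != x -> y = x -> forall a, neighbor x a -> R a (last y p)).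
  by move=> lx; exact: h.
elim: p y yA {yx} pp ap => [|y' p IH] y yA /=.
  move=> _ _; split=> [_ yx|/eqP yx /yx //].
  by apply: linked_refl; rewrite /= !inE yx.
move=> /andP[yy' pp] /and3P[_ y'A ap].
have [|h1 h2] := IH y' y'A pp; first by rewrite /= y'A.
have around u v : neighbor x u -> neighbor x v -> linked (mem (A `\ x)%fset) u v.
  move=> xu xv; apply: linked_sub (linked_around xu xv) => w /=.
  by rewrite !inE => /andP[-> /sub].
split=> lx.
  move=> yx; have [e|y'x] := eqVneq y' x.
    by apply: h2 => //; rewrite neighbor_sym -e.
  apply: (@linked_trans _ y'); last exact: h1.
  by apply: linked_step => //=; rewrite !inE ?yx ?y'x.
move=> yx a xa; rewrite yx in yy'.
have y'x : y' != x by rewrite eq_sym neighbor_neq.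
by apply: (@linked_trans _ y'); [exact: around|exact: h1].
Qed.

Lemma holes_has_neighbor A x : (cube 1 x `\ x `<=` A)%fset ->
  exists2 y, y \in A & neighbor x y.
Proof.
move=> /fsubsetP sub; exists (x + unit_step false (Ordinal d_ge2)).
  by apply: sub; exact: cubeD1_step.
exact: neighbor_step.
Qed.

Lemma in_holes A x :
  (x \in holes A) = (x \notin A) && (cube 1 x `\ x `<=` A)%fset.
Proof.
rewrite !inE /= andb_idl // => /andP[_ /holes_has_neighbor[y yA xy]].
by apply: closure1_neighbor yA _; rewrite neighbor_sym.
Qed.

(** A hole is charged to its neighbour in a fixed direction, a site of [A]. *)
Lemma card_holes A : (#|` holes A| <= #|` A|)%N.
Proof.
pose e := unit_step false (Ordinal d_ge2).
have inj : injective (fun x : site => x + e) by exact: addIr.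
have <- : #|` [fset (x + e)%R | x in holes A]%fset| = #|` holes A| by rewrite card_imfset.
apply: fsubset_leq_card; apply/fsubsetP => _ /imfsetP[x /= xH ->].
move: xH; rewrite in_holes => /andP[_ /fsubsetP]; apply; exact: cubeD1_step.
Qed.

Lemma connectedU1 A x y : path_connected A -> y \in A -> neighbor x y ->
  path_connected (x |` A)%fset.
Proof.
move=> cA yA xy; apply: (@connected_from y) => z; rewrite !inE => /predU1P[->|zA].
  by apply: linked_step; rewrite /= ?inE ?yA ?eqxx ?orbT // neighbor_sym.
by apply: linked_sub (cA _ _ yA zA) => u; rewrite /= !inE => ->; rewrite orbT.
Qed.

Lemma animal_fill n A x : animal n A -> x \in holes A -> animal n.+1 (x |` A)%fset.
Proof.
move=> /and3P[/eqP cA A0 /asboolP connA]; rewrite in_holes => /andP[xA sub].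
apply/and3P; split; first by rewrite cardfsU1 xA cA.
  by rewrite !inE A0 orbT.
have [y yA xy] := holes_has_neighbor sub.
by apply/asboolP; exact: connectedU1 yA xy.
Qed.

Lemma full_fill A x : 0 \in A -> x \in holes A -> x \in full (x |` A)%fset.
Proof.
move=> A0; rewrite in_holes in_full => /andP[xA]; rewrite cubeD1 // => ->.
by rewrite andbT; apply: contraNneq xA => ->.
Qed.

Lemma animal_dig n A x : animal n.+1 A -> x \in full A -> animal n (A `\ x)%fset.
Proof.
move=> /and3P[/eqP cA A0 /asboolP connA]; rewrite in_full => /andP[x0 sub].
have xA : x \in A by move/fsubsetP: sub; apply; exact: cube_refl.
apply/and3P; split.
- by move: cA; rewrite (cardfsD1 x) xA add1n => -[->].
- by rewrite !inE eq_sym x0.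
- by apply/asboolP; exact: connectedD1.
Qed.

Lemma holes_dig A x : x \in full A -> x \in holes (A `\ x)%fset.
Proof.
rewrite in_full in_holes => /andP[_ sub]; rewrite !inE eqxx /=.
exact: fsetSD.
Qed.

(** The unit cube around a hole contains no other hole, so filling the former
    does not alter the cube around the latter. *)
Lemma holes_fill A x : x \in holes A -> holes (x |` A)%fset = (holes A `\ x)%fset.
Proof.
rewrite in_holes => /andP[xA /fsubsetP subx]; apply/fsetP => y.
rewrite [in RHS]inE !in_holes !inE negb_or -andbA.
have [//|yx] := eqVneq y x => /=; have [//|yA] /= := boolP (y \in A).
apply/fsubsetP/fsubsetP => h z; last by move=> /h; rewrite !inE => ->; rewrite orbT.
move=> zc; have := h _ zc; rewrite !inE => /predU1P[zx|//].
case/negP: yA; apply: subx; rewrite !inE yx cube_sym -zx.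
by move: zc; rewrite !inE => /andP[].
Qed.

Lemma full_sub A B : (A `<=` B)%fset -> (full A `<=` full B)%fset.
Proof.
move=> AB; apply/fsubsetP => x; rewrite !in_full => /andP[-> h] /=.
exact: fsubset_trans AB.
Qed.

Lemma full_fill_lb A x : 0 \in A -> x \in holes A ->
  (#|` full A| < #|` full (x |` A)%fset|)%N.
Proof.
move=> A0 xH; have xF := full_fill A0 xH.
rewrite (cardfsD1 x (full (x |` A)%fset)) xF add1n ltnS.
apply: fsubset_leq_card; apply/fsubsetP => y yF.
have yx : y != x.
  apply: contraTneq xH => <-; rewrite in_holes negb_and negbK.
  by move: yF; rewrite !inE => /andP[->].
rewrite in_fsetD1 yx /=; move: yF; apply/fsubsetP; apply: full_sub.
exact: fsubsetUr.
Qed.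

Lemma card_fsetU_le A B : (#|` (A `|` B)%fset| <= #|` A| + #|` B|)%N.
Proof. by rewrite cardfsU leq_subr. Qed.

(** Only the cubes centred within distance [r.+1] of [x] can become full. *)
Lemma full_grow r A B x : (A `<=` B)%fset -> (B `<=` A `|` cube r x)%fset ->
  (#|` full B| <= #|` full A| + #|` box r.+1|)%N.
Proof.
move=> AB /fsubsetP BA.
apply: (@leq_trans #|` (full A `|` cube r.+1 x)%fset|); last first.
  by apply: leq_trans (card_fsetU_le _ _) _; rewrite leq_add2l card_cube.
apply: fsubset_leq_card; apply/fsubsetP => y; rewrite inE !in_full.
move=> /andP[-> /fsubsetP h] /=; rewrite -implyNb; apply/implyP => /fsubsetPn[z zc zA].
have := BA _ (h _ zc); rewrite inE (negPf zA) /= => zx; rewrite -(addn1 r).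
by apply: cube_trans zx _; rewrite cube_sym.
Qed.

Lemma full_fill_ub A x : (#|` full (x |` A)%fset| <= #|` full A| + #|` box 1|)%N.
Proof.
apply: (@full_grow 0 _ _ x); first exact: fsubsetUr.
apply/fsubsetP => y; rewrite !inE => /predU1P[->|->//].
by rewrite cube_refl orbT.
Qed.

End Geometry.

(** * Sums over finite sets *)

Section FsetSums.
Context {R : realType}.

Lemma in_fset_cond (I : choiceType) (S : {fset I}) (P : pred I) i :
  (i \in [fset j in S | P j]%fset) = (i \in S) && P i.
Proof. by rewrite !inE. Qed.

Lemma sum_fset_cond (I : choiceType) (S : {fset I}) (P : pred I) (F : I -> R) :
  \sum_(i <- S | P i) F i = \sum_(i <- [fset i in S | P i]%fset) F i.
Proof. by rewrite big_fset_condE. Qed.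

Lemma ler_sum_fset (I : choiceType) (S T : {fset I}) (P : pred I) (F : I -> R) :
  (forall i, 0 <= F i) -> (forall i, i \in S -> P i -> i \in T) ->
  \sum_(i <- S | P i) F i <= \sum_(i <- T) F i.
Proof.
move=> F0 sub; rewrite sum_fset_cond; set S' := [fset i in S | P i]%fset.
have S'T : (S' `<=` T)%fset.
  by apply/fsubsetP => i; rewrite !inE /= => /andP[iS Pi]; exact: sub.
rewrite (_ : \sum_(i <- S') F i = \sum_(i <- S') (if i \in S' then F i else 0)).
  rewrite (big_fset_incl _ S'T); last by move=> i _ /negPf ->.
  by apply: ler_sum => i _; case: ifP.
by rewrite big_seq [RHS]big_seq; apply: eq_bigr => i ->.
Qed.

Lemma sum_fset_const (I : choiceType) (S : {fset I}) (c : R) :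
  \sum_(i <- S) c = #|` S|%:R * c.
Proof. by rewrite big_const_seq count_predT iter_addr_0 mulr_natl. Qed.

(** Up to normalization, the variance of [X] under the weights [w] is
    nonnegative. *)
Lemma weighted_sqr_le (I : choiceType) (S : {fset I}) (w X : I -> R) :
  (forall i, 0 <= w i) -> 0 < \sum_(i <- S) w i ->
  (\sum_(i <- S) w i * X i) ^+ 2 <=
  (\sum_(i <- S) w i) * \sum_(i <- S) w i * X i ^+ 2.
Proof.
move=> w0; set W := \sum_(i <- S) w i => W0; set m := \sum_(i <- S) w i * X i.
have E c : \sum_(i <- S) w i * (X i - c) ^+ 2 =
    \sum_(i <- S) w i * X i ^+ 2 - 2 * c * m + c ^+ 2 * W.
  rewrite /m /W !mulr_sumr -sumrB -big_split; apply: eq_bigr => i _ /=; ring.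
have : 0 <= \sum_(i <- S) w i * (X i - m / W) ^+ 2.
  by apply: sumr_ge0 => i _; rewrite mulr_ge0 // sqr_ge0.
rewrite E -(pmulr_rge0 _ W0) => h; rewrite -subr_ge0; apply: le_trans h _.
by rewrite le_eqVlt; apply/orP; left; apply/eqP; field; rewrite gt_eqF.
Qed.

End FsetSums.

(** * Removing and adding centres of cubes *)

Section Counting.
Context {R : realType} {d : nat}.
Notation site := 'rV[int]_d.
Implicit Types (A B : {fset site}) (x : site) (w : {fset site} -> R).

Definition mass w n : R := \sum_(A <- animals n) w A.

Lemma box_sub r s : (r <= s)%N -> (@box d r `<=` box s)%fset.
Proof.
move=> rs; apply/fsubsetP => y; rewrite !in_box => /forallP h; apply/forallP => i.
by apply: le_trans (h i) _; rewrite lez_nat.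
Qed.

Lemma mass_ge0 w n : (forall A, 0 <= w A) -> 0 <= mass w n.
Proof. by move=> w0; apply: sumr_ge0 => A _. Qed.

Lemma swap_sum_at n x (G : {fset site} -> R) : (2 <= d)%N ->
  \sum_(A <- animals n.+1 | x \in full A) G A =
  \sum_(A <- animals n | x \in holes A) G (x |` A)%fset.
Proof.
move=> d2; rewrite sum_fset_cond [RHS]sum_fset_cond.
rewrite (_ : [fset A in animals n.+1 | x \in full A]%fset =
  [fset (x |` A)%fset | A in [fset A in animals n | x \in holes A]]%fset); last first.
  apply/fsetP => A; rewrite in_fset_cond in_animals; apply/andP/imfsetP => /=.
    move=> [aA xA]; exists (A `\ x)%fset.
      by rewrite in_fset_cond in_animals animal_dig //= holes_dig.
    rewrite fsetD1K //; move: xA; rewrite in_full => /andP[_ /fsubsetP]; apply.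
    exact: cube_refl.
  move=> [B]; rewrite in_fset_cond in_animals => /andP[aB xB] ->.
  by rewrite animal_fill //= full_fill //; case/and3P: aB.
rewrite big_imfset //= => A B.
rewrite in_fset_cond => /andP[_ xA]; rewrite in_fset_cond => /andP[_ xB] e.
move: xA xB; rewrite !in_holes // => /andP[xA _] /andP[xB _].
by rewrite -(fsetU1K xA) e fsetU1K.
Qed.

(** Filling and digging the marked centre are inverse bijections between the
    pairs (animal, hole) and the pairs (animal, full cube); they change the
    weight by the constant factor [rho]. *)
Lemma swap_sum w rho n (f : {fset site} -> site -> R) : (2 <= d)%N ->
  (forall A x, animal n A -> x \in holes A -> w (x |` A)%fset = rho * w A) ->
  \sum_(A <- animals n.+1) w A * (\sum_(x <- full A) f A x) =
  rho * \sum_(A <- animals n) w A * (\sum_(x <- holes A) f (x |` A)%fset x).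
Proof.
move=> d2 sw; set bx := @box d n.+1.
have fullB A : A \in animals n.+1 -> forall F : site -> R,
    \sum_(x <- full A) F x = \sum_(x <- bx | x \in full A) F x.
  rewrite in_animals => /animal_box /fsubsetP sub F.
  rewrite [RHS]sum_fset_cond (_ : [fset x in bx | _]%fset = full A) //.
  apply/fsetP => x; rewrite in_fset_cond andb_idl // => xA; apply: sub.
  by move: xA; rewrite inE => /andP[].
have holesB A : A \in animals n -> forall F : site -> R,
    \sum_(x <- holes A) F x = \sum_(x <- bx | x \in holes A) F x.
  rewrite in_animals => aA F.
  rewrite [RHS]sum_fset_cond (_ : [fset x in bx | _]%fset = holes A) //.
  apply/fsetP => x; rewrite in_fset_cond andb_idl // => xH.
  have /animal_box /fsubsetP := animal_fill d2 aA xH; apply.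
  by rewrite !inE eqxx.
transitivity (\sum_(x <- bx) \sum_(A <- animals n.+1 | x \in full A) w A * f A x).
  rewrite (exchange_big_dep xpredT) //= big_seq [RHS]big_seq.
  by apply: eq_bigr => A hA; rewrite fullB // mulr_sumr.
rewrite mulr_sumr.
transitivity (\sum_(x <- bx) \sum_(A <- animals n | x \in holes A)
    rho * (w A * f (x |` A)%fset x)).
  apply: eq_bigr => x _; rewrite (swap_sum_at _ _ (fun A => w A * f A x)) //.
  rewrite big_seq_cond [RHS]big_seq_cond; apply: eq_bigr => A.
  by rewrite in_animals => /andP[aA xA]; rewrite sw // mulrA.
rewrite (exchange_big_dep xpredT) //= big_seq [RHS]big_seq.
by apply: eq_bigr => A hA; rewrite holesB // !mulr_sumr.
Qed.

End Counting.

(** * Full cubes are abundant *)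

Section Pattern.
Context {R : realType} {d : nat}.
Notation site := 'rV[int]_d.
Implicit Types (A B : {fset site}) (x : site) (w : {fset site} -> R) (kappa mu : R).

Definition sparse n N m : {fset {fset site}} :=
  [fset A in fpowerset (box N) |
    [&& animal #|` A|%fset A, (n <= #|` A|%fset <= N)%N & (#|` full A|%fset <= m)%N]]%fset.

Lemma in_sparse n N m A : (A \in sparse n N m) =
  [&& animal #|` A|%fset A, (n <= #|` A|%fset <= N)%N & (#|` full A|%fset <= m)%N].
Proof.
rewrite in_fset_cond andb_idl // => /and3P[aA /andP[_ AN] _].
rewrite fpowersetE; apply: fsubset_trans (animal_box aA) _; exact: box_sub.
Qed.

Lemma box_gt0 r : (0 < #|` @box d r|%fset)%N.
Proof. by rewrite cardfs_gt0; apply/fset0Pn; exists 0; rewrite -cube0E cube_refl. Qed.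

Lemma leq_card_box12 : (#|` @box d 1|%fset <= #|` @box d 2|%fset)%N.
Proof. by apply: fsubset_leq_card; exact: box_sub. Qed.

(** An animal is determined by its union with a cube and by its trace on it. *)
Lemma insert_fiber (S : {fset {fset site}}) B x :
  (#|` [fset A in S | B == A `|` cube 1 x]%fset|%fset <= 2 ^ #|` @box d 1|%fset)%N.
Proof.
apply: (@leq_trans #|` fpowerset (cube 1 x)|%fset); last first.
  by rewrite card_fpowerset leq_pexp2l // card_cube.
pose g C : {fset site} := ((B `\` cube 1 x) `|` C)%fset.
apply: leq_trans (leq_imfset_card imfset_key g (mem (fpowerset (cube 1 x)))).
apply: fsubset_leq_card; apply/fsubsetP => A; rewrite in_fset_cond => /andP[_ /eqP BA].
apply/imfsetP; exists (A `&` cube 1 x)%fset => /=; first by rewrite fpowersetE fsubsetIr.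
apply/fsetP => y; rewrite /g BA !inE.
by case: (y \in A); case: (y \in cube 1 x).
Qed.

Lemma sum_fset_condC (I : choiceType) (S : {fset I}) (P : pred I) :
  \sum_(i <- S | P i) (1 : R) = #|` [fset i in S | P i]%fset|%fset%:R.
Proof. by rewrite sum_fset_cond sum_fset_const mulr1. Qed.

Lemma insert_count (S : {fset {fset site}}) B :
  \sum_(A <- S) \sum_(x <- (A `\ (0 : site))%fset | B == (A `|` cube 1 x)%fset) (1 : R)
  <= #|` full B|%fset%:R * 2 ^+ #|` @box d 1|%fset.
Proof.
apply: (@le_trans _ _ (\sum_(A <- S) \sum_(x <- full B | B == (A `|` cube 1 x)%fset) 1)).
  apply: ler_sum => A _; rewrite [leRHS]sum_fset_cond; apply: ler_sum_fset => // x.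
  rewrite in_fsetD1 => /andP[x0 xA] /eqP BE; rewrite in_fset_cond -BE eqxx andbT.
  by rewrite in_full x0 BE fsubsetUr.
rewrite (exchange_big_dep xpredT) //= -sum_fset_const; apply: ler_sum => x _.
by rewrite sum_fset_condC -natrX ler_nat insert_fiber.
Qed.

(** Filling a unit cube adds at most [CG] sites and creates at most [CG] full
    cubes. *)
Notation CG := #|` @box d 2|%fset.

(** Double counting of the pairs (animal, site other than the origin): filling
    the cube around the site produces one of the at most [m + CG] full cubes of
    the new animal, and [insert_fiber] bounds the number of ways back. *)
Lemma insert_step w kappa n N m : (forall A, 0 <= w A) -> 0 < kappa ->
  (forall A x, animal #|` A|%fset A -> x \in A -> w A <= kappa * w (A `|` cube 1 x)%fset) ->
  (\sum_(A <- sparse n N m) w A) * n.-1%:R <=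
  kappa * 2 ^+ #|` @box d 1|%fset * (m + CG)%:R * \sum_(A <- sparse n (N + CG) (m + CG)) w A.
Proof.
move=> w0 k0 ins; set C := CG; set S := sparse n N m; set T := sparse _ _ _.
apply: (@le_trans _ _ (\sum_(A <- S) \sum_(x <- (A `\ (0 : site))%fset)
    kappa * w (A `|` cube 1 x)%fset)).
  rewrite mulr_suml big_seq [leRHS]big_seq; apply: ler_sum => A.
  rewrite in_sparse => /and3P[aA /andP[nA _] _].
  apply: (@le_trans _ _ (\sum_(x <- (A `\ (0 : site))%fset) w A)).
    rewrite sum_fset_const mulrC; apply: ler_wpM2r => //; rewrite ler_nat.
    have A0 : 0 \in A by case/and3P: aA.
    by rewrite -subn1 leq_subLR; move: nA; rewrite (cardfsD1 0) A0.
  rewrite big_seq [leRHS]big_seq; apply: ler_sum => x; rewrite in_fsetD1 => /andP[_ xA].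
  exact: ins.
have inT A x : A \in S -> x \in A -> (A `|` cube 1 x)%fset \in T.
  rewrite !in_sparse => /and3P[aA /andP[nA AN] vA] xA.
  rewrite (animal_insert aA xA) /=; apply/andP; split; first (apply/andP; split).
  - by apply: leq_trans nA _; apply: fsubset_leq_card; exact: fsubsetUl.
  - apply: leq_trans (card_fsetU_le _ _) _; apply: leq_add => //.
    by apply: leq_trans (card_cube _ _) leq_card_box12.
  - apply: (@leq_trans (#|` full A|%fset + C)); last by rewrite leq_add2r.
    by apply: (full_grow (r := 1)) => //; exact: fsubsetUl.
apply: (@le_trans _ _ (\sum_(A <- S) \sum_(x <- (A `\ (0 : site))%fset)
    \sum_(B <- T | B == (A `|` cube 1 x)%fset) kappa * w B)).
  rewrite big_seq [leRHS]big_seq; apply: ler_sum => A AS.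
  rewrite big_seq [leRHS]big_seq; apply: ler_sum => x; rewrite in_fsetD1 => /andP[_ xA].
  rewrite -big_filter filter_pred1_uniq ?fset_uniq //; last exact: inT.
  by rewrite big_seq1.
under eq_bigr do rewrite (exchange_big_dep xpredT) //=.
rewrite exchange_big /= mulr_sumr big_seq [leRHS]big_seq; apply: ler_sum => B BT.
under eq_bigr => A _.
  rewrite (eq_bigr (fun=> kappa * w B * 1)); last by move=> x _; rewrite mulr1.
  rewrite -mulr_sumr; over.
rewrite -mulr_sumr; apply: le_trans (ler_wpM2l _ (insert_count _ _)) _.
  by rewrite mulr_ge0 // ltW.
have : #|` full B|%fset%:R <= (m + C)%:R :> R.
  by rewrite ler_nat; move: BT; rewrite in_sparse => /and3P[].
have := w0 B; set p := 2 ^+ _; have p0 : 0 <= p :> R by rewrite exprn_ge0.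
move=> wB hB; have := ler_wpM2l (mulr_ge0 (mulr_ge0 (ltW k0) wB) p0) hB.
by congr (_ <= _); ring.
Qed.

(** An animal of size [n] offers [n - 1] sites where a cube can be filled, but
    as long as it has at most [2 * CG * k] full cubes with [k <= n / L], few of
    these could be the last one filled: each step of [insert_step] then gains a
    factor [2]. *)
Lemma sparse_iter w kappa L n : (forall A, 0 <= w A) -> 0 < kappa ->
  (forall A x, animal #|` A|%fset A -> x \in A -> w A <= kappa * w (A `|` cube 1 x)%fset) ->
  (0 < L)%N -> 8 * (kappa * 2 ^+ #|` @box d 1|%fset) * CG%:R <= L%:R -> (2 <= n)%N ->
  forall k j, (k * L <= n)%N -> (j <= k)%N ->
  \sum_(A <- sparse n n (CG * k)) w A <=
  2^-1 ^+ j * \sum_(A <- sparse n (n + CG * j) (CG * k + CG * j)) w A.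
Proof.
set C := CG; move=> w0 k0 ins L0 hL n2 k j kL; elim: j => [|j IH] jk.
  by rewrite expr0 mul1r muln0 !addn0.
apply: le_trans (IH (ltnW jk)) _; rewrite exprSr -mulrA.
apply: ler_wpM2l; first by rewrite exprn_ge0 // invr_ge0.
have := insert_step n (n + C * j) (C * k + C * j) w0 k0 ins.
rewrite -/C -!addnA -mulnSr; set Dj := bigop _ _ _; set D' := bigop _ _ _.
set c := kappa * _ in hL * => step.
have D'0 : 0 <= D' by apply: sumr_ge0.
have c0 : 0 <= c by rewrite mulr_ge0 ?exprn_ge0 // ltW.
have CG : 0 <= C%:R :> R by [].
have kr : 0 <= k%:R :> R by [].
have cnt : (C * k + C * j.+1)%:R <= 2 * C%:R * k%:R :> R.
  by rewrite -!natrM ler_nat; clear -jk; nia.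
have kn : k%:R * L%:R <= n%:R :> R by rewrite -natrM ler_nat.
have kc : 8 * c * C%:R * k%:R <= n%:R.
  by apply: le_trans kn; rewrite [k%:R * _]mulrC; apply: ler_wpM2r.
have n1 : n%:R <= 2 * n.-1%:R :> R by rewrite -natrM ler_nat; clear -n2; lia.
have n0 : 0 < n.-1%:R :> R by rewrite ltr0n; clear -n2; lia.
have fac : c * (C * k + C * j.+1)%:R <= n.-1%:R / 2.
  have := ler_wpM2l c0 cnt; lra.
rewrite -(ler_pM2r n0); apply: le_trans step _.
by have := ler_wpM2r D'0 fac; lra.
Qed.

Lemma sparse_total w n N m : (forall A, 0 <= w A) ->
  \sum_(A <- sparse n N m) w A <= \sum_(n <= l < N.+1) mass w l.
Proof.
move=> w0; rewrite (_ : bigop _ _ _ =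
  \sum_(A <- sparse n N m) \sum_(n <= l < N.+1 | l == #|` A|%fset) w A); last first.
  rewrite big_seq [RHS]big_seq; apply: eq_bigr => A; rewrite in_sparse => /and3P[_ nA _].
  rewrite -big_filter filter_pred1_uniq ?iota_uniq ?big_seq1 //.
  by rewrite mem_index_iota ltnS.
rewrite (exchange_big_dep xpredT) //=; apply: ler_sum => l _.
apply: ler_sum_fset => // A; rewrite in_sparse => /and3P[aA _ _] /eqP ->.
by rewrite in_animals.
Qed.

(** About [n / L] steps of [sparse_iter] gain a factor [2 ^ (n / L)], whereas the
    limit of the roots bounds the mass of all sizes in reach, between [n] and
    [2 * n], by [mu ^ n] up to subexponential factors; that these sizes exceed
    [n] is harmless because [mu <= 1]. The power [n ^ 3] is what
    [ratio_step] consumes of the exponential decay. *)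
Lemma few_full w kappa mu : (forall A, 0 <= w A) -> 0 < kappa ->
  (forall A x, animal #|` A|%fset A -> x \in A -> w A <= kappa * w (A `|` cube 1 x)%fset) ->
  0 < mu -> mu <= 1 -> (fun n => mass w n `^ n%:R^-1) @ \oo --> mu ->
  exists2 L, (0 < L)%N & exists N, forall n, (N <= n)%N ->
    (\sum_(A <- animals n | (#|` full A|%fset * L < n)%N) w A) * n%:R ^+ 3 <= mass w n.
Proof.
move=> w0 k0 ins mu0 mu1 root; set C := #|` @box d 2|%fset.
set c := kappa * 2 ^+ #|` @box d 1|%fset.
have C1 : (0 < C)%N := box_gt0 2.
have [L [CL bL]] : exists L, (C <= L)%N /\ (Num.bound (8 * c * C%:R) <= L)%N.
  by exists (maxn C (Num.bound (8 * c * C%:R))); rewrite leq_max leqnn leq_max leqnn orbT.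
have c0 : 0 < c by rewrite mulr_gt0 // exprn_gt0.
have L0 : (0 < L)%N by exact: leq_trans CL.
have hL : 8 * c * C%:R <= L%:R.
  apply: ltW; apply: lt_le_trans (archi_boundP _) _; last by rewrite ler_nat.
  by rewrite mulr_ge0 // mulr_ge0 // ltW.
exists L => //.
have q1 : 1 < 2 :> R by lra.
have [t t1 ht] := root_gap q1 L0.
have m0 n : 0 <= mass w n by exact: mass_ge0.
have [N1 hN1] := root_lim_bounds m0 mu0 t1 root.
have [N2 hN2] := poly_le_expr t1.
exists (maxn (maxn 2 L) (maxn N1 N2)) => n; rewrite !geq_max => /andP[/andP[n2 nL] /andP[nN1 nN2]].
have tk := ht _ nL; have kL : (n %/ L * L <= n)%N by exact: leq_trunc_div.
have badk A : (#|` full A|%fset * L < n)%N -> (#|` full A|%fset <= n %/ L)%N.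
  by move=> h; rewrite leq_divRL // ltnW.
move: (n %/ L)%N tk kL badk => k tk kL badk.
have Ckn : (C * k <= n)%N.
  by apply: leq_trans kL; rewrite mulnC leq_mul2l CL orbT.
set bad := \sum_(A <- _ | _) _.
have step1 : bad <= \sum_(A <- sparse n n (C * k)) w A.
  apply: ler_sum_fset => // A; rewrite in_animals in_sparse => aA /badk vA.
  have /and3P[/eqP cA _ _] := aA.
  rewrite cA aA !leqnn /=; apply: leq_trans vA _; exact: leq_pmull.
have step2 := sparse_iter w0 k0 ins L0 hL n2 kL (leqnn k).
have step3 := sparse_total n (n + C * k) (C * k + C * k) w0.
have t0 : 0 < t by lra.
have mt l : (n <= l < (n + C * k).+1)%N -> mass w l <= mu ^+ n * t ^+ (2 * n).
  move=> /andP[nl ln]; have /andP[_ h] := hN1 l (leq_trans nN1 nl).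
  apply: le_trans h _; rewrite exprMn; apply: ler_pM.
  - by rewrite exprn_ge0 // ltW.
  - by rewrite exprn_ge0 // ltW.
  - by apply: ler_wiXn2l => //; exact: ltW.
  - by apply: ler_weXn2l; [exact: ltW|clear -ln Ckn; lia].
have step4 : \sum_(n <= l < (n + C * k).+1) mass w l <=
    (n%:R + 1) * (mu ^+ n * t ^+ (2 * n)).
  apply: (@le_trans _ _ (\sum_(n <= l < (n + C * k).+1) mu ^+ n * t ^+ (2 * n))).
    by rewrite big_nat [leRHS]big_nat; apply: ler_sum => l /mt.
  rewrite sumr_const_nat -[leLHS]mulr_natl; apply: ler_wpM2r.
    by rewrite mulr_ge0 // exprn_ge0 // ltW.
  by rewrite natr1 ler_nat; clear -Ckn; lia.
have /andP[lo _] := hN1 n nN1; apply: le_trans lo.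
have poly := hN2 n nN2.
have hb : bad <= 2^-1 ^+ k * ((n%:R + 1) * (mu ^+ n * t ^+ (2 * n))).
  apply: le_trans step1 _; apply: le_trans step2 _.
  apply: ler_wpM2l; first by rewrite exprn_ge0 // invr_ge0.
  exact: le_trans step3 step4.
have tpos j : 0 < t ^+ j by exact: exprn_gt0.
have mun : 0 < mu ^+ n by exact: exprn_gt0.
have half : 2^-1 ^+ k <= (t ^+ (4 * n))^-1.
  by rewrite exprVn lef_pV2 ?posrE ?exprn_gt0.
have n3 : 0 <= n%:R ^+ 3 :> R by rewrite exprn_ge0.
apply: le_trans (ler_wpM2r n3 hb) _.
rewrite exprMn [t^-1 ^+ _]exprVn.
have -> : 2^-1 ^+ k * ((n%:R + 1) * (mu ^+ n * t ^+ (2 * n))) * n%:R ^+ 3 =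
  2^-1 ^+ k * (mu ^+ n * (t ^+ (2 * n) * ((n%:R + 1) * n%:R ^+ 3))) by ring.
apply: (@le_trans _ _ ((t ^+ (4 * n))^-1 * (mu ^+ n * (t ^+ (2 * n) * t ^+ n)))).
  apply: ler_pM half _.
  - by rewrite exprn_ge0 // invr_ge0.
  - by rewrite !mulr_ge0 ?addr_ge0 // ltW.
  - by apply: ler_wpM2l; [exact: ltW|apply: ler_wpM2l => //; exact: ltW].
rewrite mulrC -mulrA; apply: ler_wpM2l; first exact: ltW.
have -> : (4 * n = n + (2 * n + n))%N by clear; lia.
by rewrite -exprD ler_pdivrMr // [t ^+ (n + _)]exprD mulKf // gt_eqF.
Qed.

End Pattern.

(** * The ratio inequality *)

Section RatioStep.
Context {R : realType} {d : nat}.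
Notation site := 'rV[int]_d.
Implicit Types (A B : {fset site}) (x : site) (w g : {fset site} -> R) (rho : R).

Notation u A := (#|` holes A|%fset%:R : R).
Notation v A := (#|` full A|%fset%:R : R).
Notation K := (#|` @box d 1|%fset%:R : R).

(** Give each full cube of an animal the share [g A / v A] of [g A], then dig its
    centre; the animals without a full cube are lost. *)
Lemma mass_lower w rho g n : (2 <= d)%N -> (forall A, 0 <= w A) ->
  (forall A x, animal n A -> x \in holes A -> w (x |` A)%fset = rho * w A) ->
  (forall A, 0 <= g A) ->
  rho * \sum_(A <- animals n) w A *
    (\sum_(x <- holes A) g (x |` A)%fset / v (x |` A)%fset)
  <= \sum_(A <- animals n.+1) w A * g A.
Proof.
move=> d2 w0 sw g0; rewrite -(swap_sum (fun A _ => g A / v A) d2 sw).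
apply: ler_sum => A _; apply: ler_wpM2l => //; rewrite sum_fset_const.
have [->|v0] := eqVneq (v A) 0; first by rewrite mul0r.
by rewrite mulrCA divff // mulr1.
Qed.

(** The same sharing with [g = 1]. Filling a hole creates at least one full cube,
    whence the denominator [v A + 1]. *)
Lemma mass_upper w rho n : (2 <= d)%N -> (forall A, 0 <= w A) -> 0 <= rho ->
  (forall A x, animal n A -> x \in holes A -> w (x |` A)%fset = rho * w A) ->
  mass w n.+1 <= \sum_(A <- animals n.+1 | #|` full A|%fset == 0%N) w A +
    rho * \sum_(A <- animals n) w A * (u A / (v A + 1)).
Proof.
move=> d2 w0 rho0 sw; rewrite /mass (bigID (fun A => #|` full A|%fset == 0%N)) /=.
rewrite lerD2l.
apply: (@le_trans _ _ (rho * \sum_(A <- animals n) w A *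
    (\sum_(x <- holes A) (v (x |` A)%fset)^-1))).
  rewrite -(swap_sum (fun A _ => (v A)^-1) d2 sw) big_mkcond; apply: ler_sum => A _.
  rewrite sum_fset_const; case: ifP => h; last by rewrite mulr_ge0 // mulr_ge0 // invr_ge0.
  by rewrite divff ?mulr1 // pnatr_eq0.
apply: ler_wpM2l => //; rewrite big_seq [leRHS]big_seq; apply: ler_sum => A.
rewrite in_animals => /and3P[_ A0 _]; apply: ler_wpM2l => //.
rewrite -sum_fset_const big_seq [leRHS]big_seq; apply: ler_sum => x xH.
have := full_fill_lb d2 A0 xH => lt.
rewrite natr1 lef_pV2 ?posrE ?ltr0n ?ler_nat //.
exact: leq_ltn_trans lt.
Qed.

Lemma div_shift_le (a p q k : R) : 0 <= a -> 0 < p -> p <= q + k -> 0 < k -> 0 <= q ->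
  a / (q + 2 * k) / (q + k) <= a / (p + k) / p.
Proof.
move=> a0 p0 pqk k0 q0; apply: ler_pM.
- by rewrite divr_ge0 //; lra.
- by rewrite invr_ge0; lra.
- by apply: ler_wpM2l => //; rewrite lef_pV2 ?posrE; lra.
- by rewrite lef_pV2 ?posrE //; lra.
Qed.

(** Two full cubes are dug in succession. Filling a hole creates at most [K] full
    cubes and destroys exactly one hole, which accounts for the shifts of the
    denominators and for the factor [u A - 1]. *)
Lemma mass_two_steps w rho n : (2 <= d)%N -> (forall A, 0 <= w A) -> 0 <= rho ->
  (forall n A x, animal n A -> x \in holes A -> w (x |` A)%fset = rho * w A) ->
  rho ^+ 2 * \sum_(A <- animals n) w A * (u A * (u A - 1) / ((v A + 2 * K) * (v A + K)))
  <= mass w n.+2.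
Proof.
move=> d2 w0 rho0 sw.
have K0 : 0 < K by rewrite ltr0n box_gt0.
have vK A x : v (x |` A)%fset <= v A + K by rewrite -natrD ler_nat full_fill_ub.
have v0 A x : 0 \in A -> x \in holes A -> 0 < v (x |` A)%fset.
  by move=> A0 /(full_fill_lb d2 A0) lt; rewrite ltr0n; exact: leq_ltn_trans lt.
apply: (@le_trans _ _ (\sum_(A <- animals n.+2) w A * 1)); last first.
  by under eq_bigr do rewrite mulr1.
have g1 A : 0 <= 1 :> R by [].
apply: le_trans (mass_lower d2 w0 (sw _) g1).
apply: (@le_trans _ _ (rho * \sum_(A <- animals n.+1) w A * (u A / (v A + K)))); last first.
  apply: ler_wpM2l => //; rewrite big_seq [leRHS]big_seq; apply: ler_sum => A.
  rewrite in_animals => /and3P[_ A0 _]; apply: ler_wpM2l => //.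
  rewrite -sum_fset_const big_seq [leRHS]big_seq; apply: ler_sum => x xH.
  by rewrite mul1r lef_pV2 ?posrE ?v0 // ltr_wpDl.
rewrite expr2 -mulrA; apply: ler_wpM2l => //.
have g2 A : 0 <= u A / (v A + K) by rewrite divr_ge0 // addr_ge0.
apply: le_trans (mass_lower d2 w0 (sw _) g2).
apply: ler_wpM2l => //; rewrite big_seq [leRHS]big_seq; apply: ler_sum => A.
rewrite in_animals => /and3P[_ A0 _]; apply: ler_wpM2l => //.
rewrite -mulrA -sum_fset_const big_seq [leRHS]big_seq; apply: ler_sum => x xH.
have uE : u (x |` A)%fset = u A - 1.
  by rewrite (holes_fill d2 xH) (cardfsD1 x (holes A)) xH natrD addrC addKr.
have u1 : 0 <= u A - 1 by rewrite -uE.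
have vA : 0 <= v A by [].
rewrite uE invfM mulrA; have h := vK A x; have h0 := v0 A x A0 xH.
exact: div_shift_le.
Qed.

(** With [a] holes and [p] full cubes in an animal of size [m], the shifts by
    [k] in the denominators and the missing unit in [a - 1] change the square of
    the ratio by [O(1 / p)] only, and [p >= m / l]. *)
Lemma sqr_ratio_le (a p k l m : R) : 0 <= a -> a <= m -> 0 < m -> m <= p * l ->
  0 < l -> 0 < k ->
  (a / (p + 1)) ^+ 2 <=
  a * (a - 1) / ((p + 2 * k) * (p + k)) + (3 * k * l ^+ 2 + l) * l / m.
Proof.
move=> a0 am m0 mpl l0 k0.
have p0 : 0 < p by rewrite -(pmulr_lgt0 _ l0); exact: lt_le_trans mpl.
have apl : a <= p * l by exact: le_trans mpl.
set X := a / (p + 1).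
have X0 : 0 <= X by rewrite divr_ge0 //; lra.
have Xl : X <= l by rewrite ler_pdivrMr; nra.
have pV : p^-1 <= l / m by rewrite -[leLHS]mul1r ler_pdivrMr // mulrAC ler_pdivlMr //; lra.
set P := (p + 2 * k) * (p + k).
have P0 : 0 < P by rewrite mulr_gt0; lra.
have pP : p ^+ 2 <= P by rewrite /P; nra.
have h1 : a / P <= l / p.
  rewrite ler_pdivrMr // mulrAC ler_pdivlMr //; apply: (@le_trans _ _ (l * p ^+ 2)).
    by have := ler_wpM2r (ltW p0) apl; rewrite expr2; lra.
  by apply: ler_wpM2l => //; exact: ltW.
have h2 : X ^+ 2 * (1 - 3 * k / p) <= a ^+ 2 / P.
  have -> : a ^+ 2 / P = X ^+ 2 * ((p + 1) ^+ 2 / P).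
    by rewrite /X; field; rewrite !gt_eqF //; lra.
  apply: ler_wpM2l; first exact: sqr_ge0.
  rewrite ler_pdivlMr // -(ler_pM2r p0).
  have -> : (1 - 3 * k / p) * P * p = (p - 3 * k) * P by field; rewrite gt_eqF.
  have -> : (p - 3 * k) * P = p ^+ 3 - (7 * (k ^+ 2 * p) + 6 * k ^+ 3) by rewrite /P; ring.
  have : 0 < k ^+ 2 * p by rewrite mulr_gt0 // exprn_gt0.
  have : 0 < k ^+ 3 by rewrite exprn_gt0.
  have -> : (p + 1) ^+ 2 * p = p ^+ 3 + (2 * p ^+ 2 + p) by ring.
  have : 0 < p ^+ 2 by rewrite exprn_gt0.
  lra.
have X2 : X ^+ 2 <= l ^+ 2 by apply: lerXn2r; rewrite ?nnegrE //; lra.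
have kp : 0 <= 3 * k / p by rewrite divr_ge0 //; lra.
have h3 := ler_wpM2r kp X2.
have -> : a * (a - 1) / P = a ^+ 2 / P - a / P by rewrite expr2; ring.
have h4 : (3 * k * l ^+ 2 + l) / p <= (3 * k * l ^+ 2 + l) * l / m.
  rewrite -[leRHS]mulrA; apply: ler_wpM2l => //.
  by rewrite addr_ge0 ?mulr_ge0 ?sqr_ge0 //; lra.
have e4 : (3 * k * l ^+ 2 + l) / p = l ^+ 2 * (3 * k / p) + l / p by ring.
rewrite e4 in h4; move: h2; rewrite mulrBr mulr1; lra.
Qed.

(** Write [E] for the mean over the animals of size [n] with the normalized
    weights, and [phi] for the ratios of masses. Up to errors [O(1 / n)], [phi n]
    is at most [rho * E (u / v)] by [mass_upper], and [phi n * phi n.+1] is at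
    least [rho ^ 2 * E ((u / v) ^ 2)] by [mass_two_steps]. The Cauchy-Schwarz
    inequality compares the two; [few_full] makes the animals with a small [v]
    negligible. *)
Lemma ratio_step w rho L N0 : (2 <= d)%N -> (forall A, 0 <= w A) -> 0 < rho ->
  (forall n A x, animal n A -> x \in holes A -> w (x |` A)%fset = rho * w A) ->
  (0 < L)%N -> (forall n, (N0 <= n)%N -> 0 < mass w n) ->
  (forall n, (N0 <= n)%N ->
    (\sum_(A <- animals n | (#|` full A|%fset * L < n)%N) w A) * n%:R ^+ 3 <= mass w n) ->
  exists2 D, 0 < D & exists N, forall n, (N <= n)%N ->
    (mass w n.+1 / mass w n) ^+ 2 - D / n%:R <=
    mass w n.+1 / mass w n * (mass w n.+2 / mass w n.+1).
Proof.
move=> d2 w0 rho0 sw L0 mpos few.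
have l0 : 0 < L%:R :> R by rewrite ltr0n.
have K0 : 0 < K by rewrite ltr0n box_gt0.
pose D1 : R := (3 * K * L%:R ^+ 2 + L%:R) * L%:R.
have D10 : 0 < D1 by rewrite mulr_gt0 // addr_gt0 // !mulr_gt0 // exprn_gt0.
pose Phi : R := 2 * (rho * (L%:R + 1)).
exists (rho ^+ 2 * (D1 + 1) + 2 * Phi ^+ 2).
  rewrite ltr_pwDl // ?mulr_gt0 ?exprn_gt0 ?addr_gt0 //.
  by rewrite mulr_ge0 // sqr_ge0.
exists (maxn N0 2) => n; rewrite geq_max => /andP[nN n2].
have b0 := mpos n nN; have b10 := mpos n.+1 (leqW nN).
have fw := few n nN; have fw1 := few n.+1 (leqW nN).
have n0 : 0 < n%:R :> R by rewrite ltr0n; exact: ltnW.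
have n2r : 2 <= n%:R :> R by rewrite ler_nat.
have up := mass_upper d2 w0 (ltW rho0) (sw n).
have two := mass_two_steps n d2 w0 (ltW rho0) sw.
set b := mass w n in b0 fw up two *; set b1 := mass w n.+1 in b10 fw1 up *.
set b2 := mass w n.+2 in two *.
set bad := bigop _ _ _ in fw; set bad1 := bigop _ _ _ in fw1.
have bad0 : 0 <= bad by apply: sumr_ge0.
have bad10 : 0 <= bad1 by apply: sumr_ge0.
pose X A := u A / (v A + 1).
pose Y A := u A * (u A - 1) / ((v A + 2 * K) * (v A + K)).
have X0 A : 0 <= X A by rewrite divr_ge0 // addr_ge0.
have Y0 A : 0 <= Y A.
  apply: divr_ge0; last by rewrite mulr_ge0 // addr_ge0 // mulr_ge0.
  case: #|` holes A|%fset => [|m]; first by rewrite mul0r.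
  by rewrite mulr_ge0 // subr_ge0 ler1n.
have uA A : A \in animals n -> u A <= n%:R.
  rewrite in_animals => /and3P[/eqP <- _ _]; rewrite ler_nat; exact: card_holes.
have Xu A : X A <= u A.
  by rewrite ler_pdivrMr ?ltr_wpDl // ler_peMr // lerDr.
(* the indicator of the animals with too few full cubes *)
pose chi A : R := (#|` full A|%fset * L < n)%N%:R.
have badE : bad = \sum_(A <- animals n) w A * chi A.
  rewrite /bad big_mkcond; apply: eq_bigr => A _; rewrite /chi.
  by case: ifP; rewrite ?mulr1 ?mulr0.
have goodP A : ~~ (#|` full A|%fset * L < n)%N -> n%:R <= v A * L%:R.
  by rewrite -leqNgt -natrM ler_nat.
have Xle A : A \in animals n -> X A <= L%:R + n%:R * chi A.
  move=> hA; rewrite /chi; case: (boolP (_ < _)%N) => [_|/goodP good].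
    by rewrite mulr1; apply: le_trans (Xu A) _; apply: le_trans (uA A hA) _; rewrite lerDr ltW.
  rewrite mulr0 addr0 ler_pdivrMr ?ltr_wpDl //.
  by have := uA A hA; lra.
have X2le A : A \in animals n -> X A ^+ 2 <= Y A + D1 / n%:R + n%:R ^+ 2 * chi A.
  move=> hA; rewrite /chi; case: (boolP (_ < _)%N) => [_|/goodP good].
    rewrite mulr1; apply: (@le_trans _ _ (n%:R ^+ 2)).
      by apply: lerXn2r; rewrite ?nnegrE // (le_trans (Xu A)) // uA.
    by rewrite lerDr addr_ge0 // divr_ge0 // ltW.
  by rewrite mulr0 addr0; apply: sqr_ratio_le => //; exact: uA.
set Sx := \sum_(A <- animals n) w A * X A in up.
set Sy := \sum_(A <- animals n) w A * Y A in two.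
pose Sxx := \sum_(A <- animals n) w A * X A ^+ 2.
have Sx0 : 0 <= Sx by apply: sumr_ge0 => A _; rewrite mulr_ge0.
have hSx : Sx <= L%:R * b + n%:R * bad.
  rewrite badE /Sx /b /mass !mulr_sumr -big_split big_seq [leRHS]big_seq /=.
  by apply: ler_sum => A hA; have := ler_wpM2l (w0 A) (Xle A hA); lra.
have hSxx : Sxx <= Sy + D1 / n%:R * b + n%:R ^+ 2 * bad.
  rewrite badE /Sxx /Sy /b /mass !mulr_sumr -!big_split big_seq [leRHS]big_seq /=.
  by apply: ler_sum => A hA; have := ler_wpM2l (w0 A) (X2le A hA); lra.
have CS : Sx ^+ 2 <= b * Sxx by exact: weighted_sqr_le.
have n2bad : n%:R ^+ 2 * bad <= b / n%:R.
  rewrite ler_pdivlMr //; apply: le_trans fw.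
  by rewrite le_eqVlt; apply/orP; left; apply/eqP; ring.
have nbad : n%:R * bad <= b.
  apply: le_trans (_ : n%:R ^+ 2 * bad <= _); last first.
    by apply: le_trans n2bad _; rewrite ler_pdivrMr // ler_peMr ?ltW //; lra.
  by apply: ler_wpM2r => //; rewrite expr2 ler_peMr ?ltW //; lra.
have bad1n : n%:R * bad1 <= b1.
  apply: le_trans fw1; rewrite [leLHS]mulrC; apply: ler_wpM2l => //.
  rewrite exprS; apply: (@le_trans _ _ n.+1%:R); first by rewrite ler_nat.
  by rewrite ler_peMr // exprn_ege1 // ler1n.
have e1 : \sum_(A <- animals n.+1 | #|` full A|%fset == 0%N) w A <= bad1.
  rewrite /bad1 big_mkcond [leRHS]big_mkcond; apply: ler_sum => A _.
  by case: eqP => [->|_]; [rewrite mul0n ltn0Sn|case: ifP].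
have up1 : b1 * (1 - n%:R^-1) <= rho * Sx.
  rewrite mulrBr mulr1; have : bad1 <= b1 / n%:R by rewrite ler_pdivlMr // mulrC.
  lra.
have nV : n%:R^-1 <= 2^-1 :> R by rewrite lef_pV2 ?posrE.
have nV0 : 0 < n%:R^-1 :> R by rewrite invr_gt0.
have rSx : rho * Sx <= rho * ((L%:R + 1) * b) by apply: ler_wpM2l; [exact: ltW|lra].
have Phi_b : b1 <= Phi * b.
  have : b1 * 2^-1 <= b1 * (1 - n%:R^-1) by apply: ler_wpM2l; [exact: ltW|lra].
  rewrite /Phi; lra.
have sq : (b1 * (1 - n%:R^-1)) ^+ 2 <= rho ^+ 2 * (b * Sxx).
  apply: le_trans (_ : (rho * Sx) ^+ 2 <= _).
    by apply: lerXn2r; rewrite ?nnegrE //; apply: mulr_ge0; lra.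
  by rewrite exprMn; apply: ler_wpM2l => //; exact: sqr_ge0.
have big : rho ^+ 2 * Sxx <= b2 + rho ^+ 2 * ((D1 + 1) / n%:R * b).
  apply: le_trans (_ : rho ^+ 2 * (Sy + (D1 + 1) / n%:R * b) <= _); last first.
    by rewrite mulrDr lerD2r.
  by apply: ler_wpM2l; [exact: sqr_ge0|lra].
have fin : b1 ^+ 2 * (1 - n%:R^-1) ^+ 2 <= b * (b2 + rho ^+ 2 * ((D1 + 1) / n%:R * b)).
  by rewrite -exprMn; apply: le_trans sq _; rewrite mulrCA; apply: ler_wpM2l => //; exact: ltW.
have sq1 : b1 ^+ 2 * (1 - 2 / n%:R) <= b1 ^+ 2 * (1 - n%:R^-1) ^+ 2.
  apply: ler_wpM2l; first exact: sqr_ge0.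
  by have := sqr_ge0 (n%:R^-1 : R); rewrite !expr2; lra.
have Phi2 : b1 ^+ 2 <= Phi ^+ 2 * b ^+ 2.
  by rewrite -exprMn; apply: lerXn2r; rewrite ?nnegrE //; lra.
have tn : 0 <= 2 / n%:R :> R by rewrite divr_ge0.
have Phi2n := ler_wpM2r tn Phi2.
have -> : b1 / b * (b2 / b1) = b2 * b / b ^+ 2 by field; rewrite !gt_eqF.
have -> : (b1 / b) ^+ 2 - (rho ^+ 2 * (D1 + 1) + 2 * Phi ^+ 2) / n%:R =
  (b1 ^+ 2 - b ^+ 2 * (rho ^+ 2 * (D1 + 1) / n%:R) - Phi ^+ 2 * b ^+ 2 * (2 / n%:R)) / b ^+ 2.
  by field; rewrite !gt_eqF.
apply: ler_wpM2r; first by rewrite invr_ge0 sqr_ge0.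
have eb : b * (b2 + rho ^+ 2 * ((D1 + 1) / n%:R * b)) =
  b2 * b + b ^+ 2 * (rho ^+ 2 * (D1 + 1) / n%:R) by ring.
rewrite eb in fin.
move: sq1 fin Phi2n; rewrite mulrBr mulr1; move: (b1 ^+ 2 * _) => z; lra.
Qed.

End RatioStep.

(** * Probabilities of local events *)

Section LocalEvents.
Context {R : realType} {d q : nat} {hq : (2 <= q)%N}.
Notation site := 'rV[int]_d.
Notation Omega := (@config d q hq).
Implicit Types (P : probability Omega R) (S T A B : {fset site}) (x y : site).

Definition agree S A : set Omega :=
  [set w | {in S, forall y, occupied w y = (y \in A)}].

(** For a connected [A] containing the origin, the probability that [A] is the
    cluster of the origin. *)
Definition weight P A : R := prob P (agree (closure1 A) A).

Lemma sigma_of_measurable (V : set site) (E : set Omega) :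
  sigma_of V E -> measurable E.
Proof.
move=> h; apply: (h <<s @coord_events d q hq setT >>); split.
  exact: smallest_sigma_algebra.
by move=> F [x [s [Vx ->]]]; apply: sub_sigma_algebra; exists x, s.
Qed.

Lemma sigma_of_site (V : set site) x b : V x ->
  sigma_of V ([set w | occupied w x = b] : set Omega).
Proof.
move=> Vx; have h : sigma_of V ([set w | w x = state1 hq] : set Omega).
  by apply: sub_sigma_algebra; exists x, (state1 hq).
case: b.
  rewrite (_ : [set w | _] = ([set w | w x = state1 hq] : set Omega)) //.
  by apply/seteqP; split=> w /=; rewrite /occupied => /eqP.
rewrite (_ : [set w | _] = ~` ([set w | w x = state1 hq] : set Omega)).
  exact: (@measurableC _ (g_sigma_algebraType (@coord_events d q hq V))).
by apply/seteqP; split=> w; rewrite /= /occupied; [move=> /negbT/eqP|move=> /eqP/negbTE].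
Qed.

Lemma sigma_of_agree (V : set site) S A : [set` S] `<=` V -> sigma_of V (agree S A).
Proof.
move=> SV; rewrite (_ : agree S A =
    \bigcap_(y in [set` S]) [set w | occupied w y = (y \in A)]).
  apply: (@fin_bigcap_measurable _ (g_sigma_algebraType (@coord_events d q hq V))).
    exact: finite_fset.
  by move=> y yS; apply: sigma_of_site; exact: SV.
by apply/seteqP; split=> w h y yS; exact: h.
Qed.

Lemma agree_measurable S A : measurable (agree S A).
Proof. by apply: (@sigma_of_measurable setT); exact: sigma_of_agree. Qed.

Lemma prob_ge0 P E : 0 <= prob P E.
Proof. by rewrite fine_ge0. Qed.

Lemma weight_ge0 P A : 0 <= weight P A.
Proof. exact: prob_ge0. Qed.

Lemma probE P (E : set Omega) : measurable E -> P E = (prob P E)%:E.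
Proof. by move=> mE; rewrite /prob fineK // fin_num_measure. Qed.

Lemma le_prob P (E F : set Omega) : measurable E -> measurable F -> E `<=` F ->
  prob P E <= prob P F.
Proof. by move=> mE mF EF; rewrite -lee_fin -!probE // le_measure ?inE. Qed.

Lemma agree_sub S T A : {subset S <= T} -> agree T A `<=` agree S A.
Proof. by move=> ST w h y yS; apply: h; exact: ST. Qed.

Lemma agree_eq S A B : {in S, A =i B} -> agree S A = agree S B.
Proof. by move=> AB; apply/seteqP; split=> w h y yS; rewrite h ?AB. Qed.

(** ** Finite energy *)

(** An event that ignores [x] may be intersected with any state of [x] at the
    cost of the factor [h]: integrate the conditional probability over it. *)
Lemma energy_step P : finite_energy P -> exists h : R, 0 < h < 1 /\
  forall x b (E : set Omega), sigma_of (~` [set x]) E ->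
    h * prob P E <= prob P (E `&` [set w | occupied w x = b]).
Proof.
move=> [h [h01 fe]]; exists h; split=> // x b E sE.
pose s : state hq := if b then state1 hq else Ordinal (ltnW hq).
have [f [[mf intf fE] lo _]] := fe x s.
have mE := sigma_of_measurable sE.
have ms c : measurable ([set w | occupied w x = c] : set Omega).
  by apply: (@sigma_of_measurable setT); exact: sigma_of_site.
have mss : measurable ([set w | w x = s] : set Omega).
  apply: (@sigma_of_measurable setT).
  by apply: sub_sigma_algebra; exists x, s.
have sb : [set w | w x = s] `<=` ([set w | occupied w x = b] : set Omega).
  by move=> w; rewrite /= /occupied => ->; rewrite /s; case: b {s lo fE f mf intf mss}.
have : (P (E `&` [set w | w x = s]) <= P (E `&` [set w | occupied w x = b]))%E.
  apply: le_measure; rewrite ?inE; [exact: measurableI|exact: measurableI|].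
  exact: setIS.
rewrite -fE // => le1; rewrite -lee_fin -probE; last exact: measurableI.
apply: le_trans le1; rewrite EFinM -probE // -integral_cst //.
apply: le_integral => //.
- exact: (finite_measure_integrable_cst P).
- by apply: integrableS intf => //.
move=> w _ /=; apply: le_trans lo _; apply: ereal_inf_lbound; by exists w.
Qed.

Lemma energy_extend P h : 0 < h < 1 ->
  (forall x b (E : set Omega), sigma_of (~` [set x]) E ->
    h * prob P E <= prob P (E `&` [set w | occupied w x = b])) ->
  forall S T A, h ^+ #|` T|%fset * prob P (agree S A) <= prob P (agree (S `|` T)%fset A).
Proof.
move=> /andP[h0 h1] step S T A.
have seqP (s : seq site) :
    h ^+ size s * prob P (agree S A) <= prob P (agree (S `|` [fset y in s])%fset A).
  elim: s => [|x s IH].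
    rewrite expr0 mul1r; apply: le_prob; [exact: agree_measurable..|].
    by apply: agree_sub => y; rewrite !inE orbF.
  rewrite exprS -mulrA; apply: le_trans (ler_wpM2l (ltW h0) IH) _.
  set S' := (S `|` [fset y in s])%fset; have [xS|xS] := boolP (x \in S').
    apply: le_trans (_ : prob P (agree S' A) <= _).
      by apply: ler_piMl; [exact: prob_ge0|exact: ltW].
    apply: le_prob; [exact: agree_measurable..|].
    apply: agree_sub => y; rewrite /S' !inE orbCA => /predU1P[->|//].
    by move: xS; rewrite /S' !inE.
  have sS : sigma_of (~` [set x]) (agree S' A).
    by apply: sigma_of_agree => y /= yS' yx; move: xS; rewrite -yx yS'.
  apply: le_trans (step x (x \in A) _ sS) _.
  apply: le_prob; last 1 first.
  - move=> w [wS wx] y; rewrite !inE orbCA => /predU1P[->//|yS].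
    by apply: wS; rewrite /S' !inE.
  - apply: measurableI; first exact: agree_measurable.
    by apply: (@sigma_of_measurable setT); exact: sigma_of_site.
  - exact: agree_measurable.
have [s <- <-] : exists2 s : seq site, [fset y in s]%fset = T & size s = #|` T|%fset.
  by exists (enum_fset T) => //; apply/fsetP => y; rewrite !inE.
exact: seqP.
Qed.

(** Two patterns that coincide outside a finite set [T] have comparable
    weights: forget the sites of [T], then prescribe them anew. *)
Lemma weight_modify P h : 0 < h < 1 ->
  (forall x b (E : set Omega), sigma_of (~` [set x]) E ->
    h * prob P E <= prob P (E `&` [set w | occupied w x = b])) ->
  forall T A B, (forall y, y \notin T -> (y \in A) = (y \in B)) ->
  (closure1 B `<=` closure1 A `|` T)%fset ->
  h ^+ #|` T|%fset * weight P A <= weight P B.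
Proof.
move=> h01 step T A B AB clAB; have /andP[h0 _] := h01.
apply: (@le_trans _ _ (h ^+ #|` T|%fset * prob P (agree (closure1 A `\` T)%fset A))).
  apply: ler_wpM2l; first by rewrite exprn_ge0 // ltW.
  apply: le_prob; [exact: agree_measurable..|].
  by apply: agree_sub => y; rewrite inE => /andP[].
rewrite (@agree_eq _ A B); last by move=> y; rewrite inE => /andP[yT _]; exact: AB.
apply: le_trans (energy_extend h01 step _ T B) _.
apply: le_prob; [exact: agree_measurable..|].
apply: agree_sub => y /(fsubsetP clAB); rewrite !inE => /orP[->|->]; last by rewrite orbT.
by rewrite andbT orNb.
Qed.

Lemma weight_insert P : finite_energy P -> exists2 kappa, 0 < kappa &
  forall A x, x \in A -> weight P A <= kappa * weight P (A `|` cube 1 x)%fset.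
Proof.
move=> /energy_step[h [h01 step]]; have /andP[h0 h1] := h01.
exists (h ^- #|` @box d 2|%fset); first by rewrite invr_gt0 exprn_gt0.
move=> A x xA; rewrite ler_pdivlMl ?exprn_gt0 //.
(* filling [cube 1 x] affects the prescription on [cube 2 x] only *)
have := @weight_modify P h h01 step (cube 2 x) A (A `|` cube 1 x)%fset.
move=> /(_ _ _)/(le_trans _); apply.
- by apply: ler_wpM2r; [exact: weight_ge0|apply: ler_wiXn2l (card_cube _ _); exact: ltW].
- move=> y; apply: contraNeq; rewrite inE; case: (y \in A) => //= yc.
  have : y \in cube 1 x by case: (y \in cube 1 x) yc.
  rewrite !in_cube => /forallP hc; apply/forallP => i.
  by apply: le_trans (hc i) _.
apply/fsubsetP => y /closure1P[z]; rewrite !inE => /orP[zA zy|zc zy].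
  by apply/orP; left; apply/closure1P; exists z.
apply/orP; right; case/predU1P: zy => [<-|zy].
  move: zc; rewrite !in_cube => /forallP hc; apply/forallP => i.
  by apply: le_trans (hc i) _.
by apply: (cube_trans (r := 1) (s := 1)) zc _; exact: neighbor_cube.
Qed.

End LocalEvents.

(** * Translation and filling of a hole *)

Section Swap.
Context {R : realType} {d q : nat} {hq : (2 <= q)%N}.
Notation site := 'rV[int]_d.
Notation Omega := (@config d q hq).
Implicit Types (P : probability Omega R) (S T A B : {fset site}) (x y a : site).

(** ** Translations *)

Definition fshift a A : {fset site} := [fset (y + a)%R | y in A]%fset.

Lemma in_fshift a A y : (y \in fshift a A) = (y - a \in A).
Proof.
apply/imfsetP/idP => /= [[z zA ->]|yA]; first by rewrite addrK.
by exists (y - a); rewrite ?subrK.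
Qed.

Lemma prob_agree_shift P a S A : translation_invariant P ->
  prob P (agree (fshift a S) (fshift a A)) = prob P (agree S A).
Proof.
move=> inv; rewrite /prob -(inv a (agree S A) (agree_measurable _ _)).
congr (fine (P _)); apply/seteqP; split=> w h y yS /=.
  rewrite /translate /occupied; have := h (y + a).
  by rewrite !in_fshift addrK; apply.
rewrite in_fshift in yS; have := h _ yS; rewrite /occupied /translate subrK => ->.
by rewrite in_fshift.
Qed.

Lemma closure1_shift a A : closure1 (fshift a A) = fshift a (closure1 A).
Proof.
apply/fsetP => y; rewrite in_fshift; apply/closure1P/closure1P => -[x xA xy].
  exists (x - a); first by rewrite -in_fshift.
  by rewrite neighborDr (inj_eq (addIr _)).
exists (x + a); first by rewrite in_fshift addrK.
by rewrite -(subrK a y) neighborDr (inj_eq (addIr _)).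
Qed.

Lemma weight_shift P a A : translation_invariant P ->
  weight P (fshift a A) = weight P A.
Proof. by move=> inv; rewrite /weight closure1_shift prob_agree_shift. Qed.

(** ** Filling a hole *)

Definition star x : {fset site} := (closure1 [fset x] `\ x)%fset.

Lemma in_star x y : (y \in star x) = neighbor x y.
Proof.
rewrite in_fsetD1; apply/andP/idP => [[yx /closure1P[z]]|xy].
  by rewrite inE => /eqP -> /predU1P[e|//]; rewrite e eqxx in yx.
rewrite eq_sym neighbor_neq //; split=> //.
by apply: closure1_neighbor xy; rewrite inE.
Qed.

Lemma closure1_fill A x : (2 <= d)%N -> x \in holes A ->
  closure1 (x |` A)%fset = closure1 A.
Proof.
move=> d2; rewrite in_holes // => /andP[xA sub]; apply/fsetP => y.
apply/idP/idP => /closure1P[z zA zy]; last first.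
  by apply/closure1P; exists z => //; rewrite !inE zA orbT.
move: zA; rewrite !inE => /predU1P[zx|zA]; last by apply/closure1P; exists z.
rewrite zx in zy; case/predU1P: zy => [<-|xy].
  have [u uA xu] := holes_has_neighbor d2 sub.
  by apply: closure1_neighbor uA _; rewrite neighbor_sym.
apply: sub_closure1; move/fsubsetP: sub; apply.
by rewrite in_fsetD1 eq_sym neighbor_neq //= neighbor_cube.
Qed.

Lemma neighbor_origin x y : neighbor x (y + x) = neighbor 0 y.
Proof. by rewrite -{1}(add0r x) neighborDr. Qed.

Definition center_event x (b : bool) : set Omega :=
  agree (star x) (star x) `&` [set w | occupied w x = b].

(** The neighbours of a hole are occupied, whether it is filled or not. Hence
    the pattern splits into these neighbours, the centre, and a set of sites off
    both, as in the boundary Markov property for [V = [set x]]. *)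
Lemma agree_split A x b : (2 <= d)%N -> x \in holes A ->
  agree (closure1 A) (if b then x |` A else A)%fset =
  agree (star x) (star x) `&` ([set w : Omega | occupied w x = b] `&`
    agree (closure1 A `\` closure1 [fset x])%fset A).
Proof.
move=> d2 xH; move: (xH); rewrite in_holes // => /andP[xA sub].
have starA y : y \in star x -> y \in A.
  rewrite in_star => xy; move/fsubsetP: sub; apply.
  by rewrite in_fsetD1 eq_sym neighbor_neq //= neighbor_cube.
have xcl : x \in closure1 A.
  have [u uA xu] := holes_has_neighbor d2 sub.
  by apply: closure1_neighbor uA _; rewrite neighbor_sym.
have A'x : (x \in (if b then x |` A else A)%fset) = b.
  by case: b; rewrite ?inE ?eqxx // (negPf xA).
have A'y y : y != x -> (y \in (if b then x |` A else A)%fset) = (y \in A).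
  by move=> yx; case: b {A'x}; rewrite // !inE (negPf yx).
apply/seteqP; split=> [w h|w [h1 [h2 h3]] y ycl].
  split; last split.
  - move=> y ys; have yA := starA _ ys; rewrite h ?sub_closure1 // A'y ?yA ?ys //.
    by move: ys; rewrite in_fsetD1 => /andP[].
  - by rewrite /= h.
  - move=> y; rewrite in_fsetD => /andP[ynx ycl]; rewrite h // A'y //.
    by apply: contraNneq ynx => ->; apply: sub_closure1; rewrite inE.
have [->|yx] := eqVneq y x; first by rewrite A'x.
rewrite A'y //; have [ys|ys] := boolP (y \in star x); first by rewrite h1 // ys starA.
apply: h3; rewrite in_fsetD ycl andbT; apply: contra ys => yc.
by rewrite in_fsetD1 yx.
Qed.

Lemma center_event_prob P x b : translation_invariant P ->
  prob P (center_event x b) = prob P (center_event 0 b).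
Proof.
move=> inv.
have m0 : measurable (center_event 0 b).
  apply: measurableI; first exact: agree_measurable.
  by apply: (@sigma_of_measurable _ _ _ setT); exact: sigma_of_site.
rewrite /prob -(inv x _ m0); congr (fine (P _)).
apply/seteqP; split=> w [/= h1 h2]; split.
- move=> y; rewrite in_star => y0; have := h1 (y + x).
  by rewrite !in_star neighbor_origin y0 /translate /occupied; apply.
- by rewrite /= /occupied /translate add0r.
- move=> y; rewrite in_star => xy; have := h1 (y - x).
  rewrite !in_star -(neighbor_origin x) subrK xy /translate /occupied subrK.
  by apply.
- by move: h2; rewrite /occupied /translate add0r.
Qed.

Lemma boundary_starE x : [set w : Omega |
  forall y, outer_boundary [set x] y -> w y = state1 hq] = agree (star x) (star x).
Proof.
apply/seteqP; split=> w h y.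
  move=> ys; rewrite ys /occupied h ?eqxx //; exists x => //; split.
    by rewrite /= -in_star.
  by move=> /= yx; move: ys; rewrite yx in_star (negPf (neighbor_irr x)).
move=> [z /= -> [xy _]]; have ys : y \in star x by rewrite in_star.
by have := h _ ys; rewrite ys => /eqP.
Qed.

(** Given that the neighbours of [x] are occupied, the state of [x] is independent
    of the rest of the pattern. So [rho] is the ratio of the probabilities of the
    two states of the centre, which by translation invariance is the same for all
    holes. *)
Lemma weight_fill P : (2 <= d)%N -> translation_invariant P -> finite_energy P ->
  boundary_markov P (state1 hq) ->
  exists2 rho, 0 < rho &
    forall A x, x \in holes A -> weight P (x |` A)%fset = rho * weight P A.
Proof.
move=> d2 inv /energy_step[h [h01 step]] markov; have /andP[h0 h1] := h01.
have Bpos x : 0 < prob P (agree (star x) (star x)).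
  have := energy_extend h01 step fset0 (star x) (star x); rewrite fset0U.
  apply: lt_le_trans; rewrite mulr_gt0 ?exprn_gt0 //.
  rewrite (_ : agree fset0 _ = setT); last by apply/seteqP; split.
  by rewrite /prob probability_setT.
have pos b : 0 < prob P (center_event 0 b).
  have sB : sigma_of (~` [set 0]) (agree (star (0 : site)) (star 0) : set Omega).
    apply: sigma_of_agree => y /= ys y0; move: ys.
    by rewrite y0 in_star (negPf (neighbor_irr _)).
  by apply: lt_le_trans (step _ b _ sB); rewrite mulr_gt0.
exists (prob P (center_event 0 true) / prob P (center_event 0 false)).
  by rewrite divr_gt0.
move=> A x xH; set F := agree (closure1 A `\` closure1 [fset x])%fset A : set Omega.
have split b : prob P (agree (closure1 A) (if b then x |` A else A)%fset) *
    prob P (agree (star x) (star x)) =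
    prob P (center_event 0 b) * prob P (agree (star x) (star x) `&` F).
  have := markov [set x] (finite_set1 x); rewrite boundary_starE /=.
  move=> /(_ _ [set w : Omega | occupied w x = b] F _ _).
  rewrite probE; last exact: agree_measurable.
  rewrite lte_fin => /(_ (Bpos x)).
  have sE : sigma_of [set x] ([set w : Omega | occupied w x = b]).
    exact: sigma_of_site.
  have sF : sigma_of (~` ([set x] `|` outer_boundary [set x])) F.
    apply: sigma_of_agree => y /=; rewrite in_fsetD => /andP[ynx _].
    move=> [yx|[z /= zx [zy _]]]; case/negP: ynx; apply/closure1P; exists x.
    - by rewrite inE.
    - by rewrite yx eqxx.
    - by rewrite inE.
    - by rewrite -zx zy orbT.
  move=> /(_ sE sF); rewrite /cond_prob !(setIC _ (agree (star x) (star x))) -(agree_split b d2 xH).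
  rewrite -[prob P (_ `&` [set w | _])]/(prob P (center_event x b)).
  rewrite center_event_prob // => e.
  have B0 : prob P (agree (star x) (star x)) != 0 by rewrite gt_eqF.
  apply: (mulIf (invr_neq0 B0)); rewrite -!mulrA divff // mulr1.
  apply: (mulIf (invr_neq0 B0)); rewrite e; ring.
rewrite {1}/weight closure1_fill //.
have := split true; have := split false => /=; rewrite -/(weight P A) => e0 e1.
have B0 := Bpos x; have p0 := pos false.
apply: (mulIf (lt0r_neq0 B0)); rewrite e1 -mulrA e0; field.
by rewrite gt_eqF.
Qed.

End Swap.

(** * Left endpoints and mass transport *)

Section LeftEndpoint.
Context {d : nat}.
Notation site := 'rV[int]_d.
Implicit Types (A : {fset site}) (x y z a : site).

Lemma lex_le_refl x : lex_le x x.
Proof. by rewrite /lex_le lexx. Qed.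

Lemma lex_le_total x y : lex_le x y || lex_le y x.
Proof. exact: le_total. Qed.

Lemma lex_le_trans y x z : lex_le x y -> lex_le y z -> lex_le x z.
Proof. exact: le_trans. Qed.

Lemma lex_le_anti x y : lex_le x y -> lex_le y x -> x = y.
Proof.
move=> xy yx; apply: site_ext => i.
have e : [tuple x ord0 i | i < d] = [tuple y ord0 i | i < d] :> d.-tuple int.
  by apply: (@le_anti _ (d.-tuplelexi int)); apply/andP.
by have := congr1 (fun t => tnth t i) e; rewrite !tnth_mktuple.
Qed.

Lemma lex_leD x y a : lex_le (x + a) (y + a) = lex_le x y.
Proof.
rewrite /lex_le; apply/lexi_tupleP/lexi_tupleP => -[k h]; exists k => i ik;
  have := h i ik; rewrite !tnth_mktuple !mxE /Order.leif lerD2r (inj_eq (addIr _)) //.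
Qed.

Definition left_at A y : bool := (y \in A) && all (lex_le y) A.

Lemma left_atP A y : is_left_endpoint [set` A] y <-> left_at A y.
Proof.
split=> [[_ yA /= h]|/andP[yA /allP h]]; first by apply/andP; split=> //; apply/allP.
by split.
Qed.

Lemma left_at_exists A x : x \in A -> exists y, left_at A y.
Proof.
have mins (s : seq site) : x \in s -> exists2 y, y \in s & all (lex_le y) s.
  case: s => // z s _; elim: s z => [|t s IH] z.
    by exists z; rewrite ?mem_head //= lex_le_refl.
  have [y ys /allP yle] := IH t; have /orP[zy|yz] := lex_le_total z y.
    exists z; first exact: mem_head.
    apply/allP => u; rewrite inE => /predU1P[->|/yle]; first exact: lex_le_refl.
    exact: lex_le_trans.
  exists y; first by rewrite inE ys orbT.
  by apply/allP => u; rewrite inE => /predU1P[->//|/yle].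
by move=> /mins[y yA ya]; exists y; apply/andP.
Qed.

Lemma left_at_uniq A y z : left_at A y -> left_at A z -> y = z.
Proof.
by move=> /andP[yA /allP h] /andP[zA /allP h']; apply: lex_le_anti; [exact: h|exact: h'].
Qed.

Lemma left_at_shift a A y : left_at (fshift a A) (y + a) = left_at A y.
Proof.
rewrite /left_at in_fshift addrK; congr (_ && _).
apply/allP/allP => h z zA.
  have := h (z + a); rewrite lex_leD; apply.
  by change (z + a \in fshift a A); rewrite in_fshift addrK.
have zA' : z - a \in A by rewrite -in_fshift.
by have := h _ zA'; rewrite -(lex_leD _ _ a) subrK.
Qed.

Lemma fshiftD a b A : fshift a (fshift b A) = fshift (b + a) A.
Proof. by apply/fsetP => y; rewrite !in_fshift opprD addrA addrAC. Qed.

Lemma fshift0 A : fshift 0 A = A.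
Proof. by apply/fsetP => y; rewrite in_fshift subr0. Qed.

Lemma card_fshift a A : #|` fshift a A|%fset = #|` A|%fset.
Proof. by rewrite card_imfset //; exact: addIr. Qed.

Lemma path_translate a x p :
  path (@neighbor d) (x + a) [seq z + a | z <- p] = path (@neighbor d) x p.
Proof. by elim: p x => //= y p IH x; rewrite neighborDr IH. Qed.

Lemma connected_shift a A : path_connected A -> path_connected (fshift a A).
Proof.
move=> cA x y; rewrite !in_fshift => xA yA; have [p [pp lp ap]] := cA _ _ xA yA.
exists [seq z + a | z <- p]; split.
- by rewrite -(subrK a x) path_translate.
- by rewrite -(subrK a x) (last_map (fun z => z + a)) lp subrK.
- rewrite -(subrK a x) -(map_cons (fun z => z + a)); apply/allP => _ /mapP[z zp ->].
  by change (z + a \in fshift a A); rewrite in_fshift addrK; move/allP: ap; apply.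
Qed.

Lemma animal_shift n a A : animal n A -> - a \in A -> animal n (fshift a A).
Proof.
move=> /and3P[/eqP cA _ /asboolP connA] aA; apply/and3P; split.
- by rewrite card_fshift cA.
- by rewrite in_fshift sub0r.
- by apply/asboolP; exact: connected_shift.
Qed.

End LeftEndpoint.

Section MassTransport.
Context {R : realType} {d : nat}.
Notation site := 'rV[int]_d.
Implicit Types (A : {fset site}) (x y z a : site) (w : {fset site} -> R).

Definition left_mass w n : R := \sum_(A <- animals n | left_at A 0) w A.

(** Mass transport: moving any one of the [n] sites of an animal based at its
    left endpoint to the origin gives each animal of size [n] exactly once. *)
Lemma mass_left w n : (forall a A, w (fshift a A) = w A) ->
  mass w n = n%:R * left_mass w n.
Proof.
move=> inv; set bx := @box d n.
have animal_in A x : A \in animals n -> x \in A -> x \in bx.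
  by rewrite in_animals => /animal_box /fsubsetP; apply.
have -> : mass w n = \sum_(y <- bx) \sum_(A <- animals n | left_at A y) w A.
  rewrite (exchange_big_dep xpredT) //= /mass big_seq [RHS]big_seq.
  apply: eq_bigr => A hA; have A0 : 0 \in A by move: hA; rewrite in_animals => /and3P[].
  have [y yA] := left_at_exists A0.
  rewrite sum_fset_cond (_ : [fset z in bx | left_at A z]%fset = [fset y]%fset).
    by rewrite big_seq_fset1.
  apply/fsetP => z; rewrite in_fset_cond inE; apply/andP/eqP => [[_ zA]|->].
    exact: left_at_uniq zA yA.
  by split=> //; apply: animal_in hA _; case/andP: yA.
have -> : n%:R * left_mass w n =
    \sum_(y <- bx) \sum_(A <- animals n | left_at A 0 && (- y \in A)) w A.
  rewrite (exchange_big_dep (fun A => left_at A 0)) => [|y A _ /andP[]//].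
  rewrite /left_mass mulr_sumr big_seq_cond [RHS]big_seq_cond.
  apply: eq_bigr => A /andP[hA l0]; rewrite l0 /=.
  rewrite sum_fset_cond sum_fset_const; congr (_%:R * _).
  have hA' := hA; rewrite in_animals in hA'; have /and3P[/eqP <- _ _] := hA'.
  have -> : [fset y in bx | - y \in A]%fset = [fset - x | x in A]%fset.
    apply/fsetP => y; rewrite in_fset_cond; apply/andP/imfsetP => /= [[_ yA]|[x xA ->]].
      by exists (- y); rewrite ?opprK.
    rewrite opprK; split=> //; have := animal_in _ _ hA xA.
    by rewrite !in_box => /forallP h; apply/forallP => i; rewrite mxE normrN.
  by rewrite card_imfset //; exact: oppr_inj.
apply: eq_bigr => y _; rewrite sum_fset_cond [RHS]sum_fset_cond.
rewrite (_ : [fset A in animals n | left_at A y]%fset =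
  [fset fshift y A | A in [fset A in animals n | left_at A 0 && (- y \in A)]]%fset).
  rewrite big_imfset /=; first by apply: eq_bigr => A _; rewrite inv.
  by move=> A B _ _ /(congr1 (fshift (- y))); rewrite !fshiftD subrr !fshift0.
apply/fsetP => A; rewrite in_fset_cond in_animals; apply/andP/imfsetP => /=.
  move=> [aA lA]; exists (fshift (- y) A); last by rewrite fshiftD addNr fshift0.
  rewrite in_fset_cond in_animals -(left_at_shift y) fshiftD addNr fshift0 add0r lA /=.
  have /and3P[_ A0 _] := aA.
  by rewrite animal_shift ?opprK /= ?in_fshift ?opprK ?addNr //; case/andP: lA.
move=> [B]; rewrite in_fset_cond in_animals => /and3P[aB l0 yB] ->.
by rewrite animal_shift // -[X in left_at _ X]add0r left_at_shift.
Qed.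

End MassTransport.

(** * Cluster size events *)

Section ClusterEvents.
Context {R : realType} {d q : nat} {hq : (2 <= q)%N}.
Notation site := 'rV[int]_d.
Notation Omega := (@config d q hq).
Implicit Types (P : probability Omega R) (A B : {fset site}) (w : Omega).

Lemma cluster_animalE n A w : animal n A ->
  occ_cluster w 0 = [set` A] <-> agree (closure1 A) A w.
Proof. by move=> /and3P[_ A0 /asboolP cA]; exact: cluster_eqP. Qed.

Lemma cluster_animal n w : (0 < n)%N -> (occ_cluster w 0 #= `I_n)%card ->
  exists2 A, animal n A & occ_cluster w 0 = [set` A].
Proof.
move=> n0 cn; have fin : finite_set (occ_cluster w 0).
  by apply/finite_setP; exists n.
have cA := card_fset_set cn.
move: cA; set A := fset_set _ => cA.
have CA : occ_cluster w 0 = [set` A] by rewrite fset_setK.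
exists A => //.
have [y yA] : exists y, y \in A by apply/fset0Pn; rewrite -cardfs_gt0 cA.
have w0 : occupied w 0.
  have : [set` A] y by []; rewrite -CA => -[p [_ _ /=]].
  by case/andP.
have [A0 connA] := cluster_connected w0 CA.
by rewrite /animal cA eqxx A0; apply/asboolP.
Qed.

Lemma size_eq_cluster n : (0 < n)%N ->
  size_eq (fun w : Omega => occ_cluster w 0) n =
  \bigcup_(A in [set` animals n]) agree (closure1 A) A.
Proof.
move=> n0; apply/seteqP; split=> w.
  move=> /(cluster_animal n0)[A aA CA]; exists A; first by rewrite /= in_animals.
  exact/(cluster_animalE _ aA).
move=> [A]; rewrite /= in_animals => aA /(cluster_animalE _ aA) CA.
rewrite /size_eq /= CA; apply/card_eq_fsetP.
by case/and3P: aA => /eqP.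
Qed.

Definition left_animals n : {fset {fset site}} :=
  [fset A in animals n | left_at A 0]%fset.

Lemma size_eq_left n : (0 < n)%N ->
  size_eq (fun w : Omega => left_cluster w 0) n =
  \bigcup_(A in [set` left_animals n]) agree (closure1 A) A.
Proof.
move=> n0; apply/seteqP; split=> w; rewrite /size_eq /left_cluster /=.
  case: asboolP => [lC cn|_ /card_fset_set]; last first.
    by rewrite fset_set0 cardfs0 => e; rewrite -e in n0.
  have [A aA CA] := cluster_animal n0 cn; exists A; last exact/(cluster_animalE _ aA).
  by rewrite /= in_fset_cond in_animals aA; apply/left_atP; rewrite -CA.
move=> [A]; rewrite /= in_fset_cond in_animals => /andP[aA /left_atP lA].
move=> /(cluster_animalE _ aA) CA; rewrite CA; case: asboolP => // _.
by apply/card_eq_fsetP; case/and3P: aA => /eqP.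
Qed.

Lemma prob_bigcup_agree P n (S : {fset {fset site}}) : (S `<=` animals n)%fset ->
  prob P (\bigcup_(A in [set` S]) agree (closure1 A) A) = \sum_(A <- S) weight P A.
Proof.
move=> /fsubsetP Sn; rewrite /prob measure_fin_bigcup.
- rewrite fsbig_finite ?set_fsetK; last exact: finite_fset.
  rewrite (eq_bigr (fun A => (weight P A)%:E)) ?sumEFin // => A _.
  exact: probE (agree_measurable _ _).
- exact: finite_fset.
- apply/trivIsetP => A B /= /Sn; rewrite in_animals => aA /Sn; rewrite in_animals => aB AB.
  apply/eqP/negPn/negP => /set0P[w [/(cluster_animalE _ aA) CA /(cluster_animalE _ aB) CB]].
  case/negP: AB; apply/eqP.
  by rewrite -(set_fsetK A) -CA CB set_fsetK.
- by move=> A _; exact: agree_measurable.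
Qed.

Lemma prob_size_eq P n : (0 < n)%N ->
  prob P (size_eq (fun w : Omega => occ_cluster w 0) n) = mass (weight P) n.
Proof. by move=> n0; rewrite size_eq_cluster // (prob_bigcup_agree _ (fsubset_refl _)). Qed.

Lemma prob_size_eq_left P n : (0 < n)%N ->
  prob P (size_eq (fun w : Omega => left_cluster w 0) n) = left_mass (weight P) n.
Proof.
move=> n0; rewrite size_eq_left // (@prob_bigcup_agree _ n).
  by rewrite /left_mass [RHS]sum_fset_cond.
by apply/fsubsetP => A; rewrite in_fset_cond => /andP[].
Qed.

Notation Lc := (fun w : Omega => left_cluster w 0).

Lemma size_eq_left_measurable n : (0 < n)%N -> measurable (size_eq Lc n).
Proof.
move=> n0; rewrite size_eq_left //; apply: fin_bigcup_measurable.
  exact: finite_fset.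
by move=> A _; exact: agree_measurable.
Qed.

Lemma size_ge_finP n w : size_ge_fin Lc n w <-> exists2 m, (n <= m)%N & size_eq Lc m w.
Proof.
rewrite /size_ge_fin /size_eq /=; split=> [[/finite_setP[m cm] nm]|[m nm cm]].
  by exists m => //; rewrite -card_le_II -(card_le_eqr cm).
split; first by apply/finite_setP; exists m.
by rewrite (card_le_eqr cm) card_le_II.
Qed.

Lemma size_ge_fin_measurable n : (0 < n)%N -> measurable (size_ge_fin Lc n).
Proof.
move=> n0; rewrite (_ : size_ge_fin Lc n = \bigcup_m size_eq Lc (n + m)).
  apply: bigcupT_measurable => m; apply: size_eq_left_measurable.
  by rewrite addn_gt0 n0.
apply/seteqP; split=> w.
  by move=> /size_ge_finP[m nm cm]; exists (m - n)%N => //; rewrite subnKC.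
by move=> [m _ cm]; apply/size_ge_finP; exists (n + m)%N; rewrite ?leq_addr.
Qed.

Lemma size_eq_uniq m n w : size_eq Lc m w -> size_eq Lc n w -> m = n.
Proof. by rewrite /size_eq /= => /card_fset_set <- /card_fset_set <-. Qed.

Lemma prob_tail P n : (0 < n)%N -> prob P (size_ge_fin Lc n) =
  prob P (size_eq Lc n) + prob P (size_ge_fin Lc n.+1).
Proof.
move=> n0; have m1 := size_eq_left_measurable n0; have m2 := size_ge_fin_measurable (ltn0Sn n).
apply: EFin_inj; rewrite EFinD -!probE //; last exact: size_ge_fin_measurable.
rewrite -measureU //; last first.
  apply/seteqP; split=> // w [h1 /size_ge_finP[m nm h2]].
  by move: nm; rewrite (size_eq_uniq h1 h2) ltnn.
congr (P _); apply/seteqP; split=> w.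
  move=> /size_ge_finP[m]; rewrite leq_eqVlt => /predU1P[->|nm] h; first by left.
  by right; apply/size_ge_finP; exists m.
move=> [h|/size_ge_finP[m nm h]]; apply/size_ge_finP; first by exists n.
by exists m => //; exact: ltnW.
Qed.

Lemma prob_tail_cvg0 P : (fun n => prob P (size_ge_fin Lc n.+1)) @ \oo --> (0 : R).
Proof.
have cap0 : \bigcap_n size_ge_fin Lc n.+1 = set0.
  apply/seteqP; split=> // w h; have /size_ge_finP[m _ cm] := h 0%N I.
  have /size_ge_finP[k mk ck] := h m I.
  by move: mk; rewrite (size_eq_uniq cm ck) ltnn.
have : (P \o (fun n => size_ge_fin Lc n.+1)) n @[n --> \oo] --> P (\bigcap_n size_ge_fin Lc n.+1).
  apply: nonincreasing_cvg_mu => [|n||].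
  - by apply: le_lt_trans (probability_le1 _ _) (ltry _); exact: size_ge_fin_measurable.
  - exact: size_ge_fin_measurable.
  - by rewrite cap0.
  - move=> n m nm; apply/subsetPset => w /size_ge_finP[k mk ck]; apply/size_ge_finP.
    by exists k => //; apply: leq_trans mk.
rewrite cap0 measure0 => /fine_cvgP[_].
by apply: cvg_trans; apply: near_eq_cvg; near=> n.
Unshelve. all: end_near.
Qed.

End ClusterEvents.

Theorem corollary1p12 (R : realType) (d q : nat) (hd : (2 <= d)%N)
    (hq : (2 <= q)%N) (P : probability (@config d q hq) R) (mu : R)
    (hinv : translation_invariant P)
    (hfe : finite_energy P)
    (hmarkov : boundary_markov P (state1 hq))
    (hmu0 : 0 < mu) (hmu1 : mu <= 1)
    (hlim_eq : (fun n : nat =>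
        prob P (size_eq (fun w => occ_cluster w 0) n) `^ (n%:R^-1)) @ \oo --> mu)
    (hlim_ge : (fun n : nat =>
        prob P (size_ge_fin (fun w => occ_cluster w 0) n) `^ (n%:R^-1)) @ \oo --> mu) :
  ((fun n : nat =>
      prob P (size_eq (fun w => left_cluster w 0) n.+1)
      / prob P (size_eq (fun w => left_cluster w 0) n)) @ \oo --> mu)
  /\
  ((fun n : nat =>
      prob P (size_ge_fin (fun w => left_cluster w 0) n.+1)
      / prob P (size_ge_fin (fun w => left_cluster w 0) n)) @ \oo --> mu).
Proof.
set w := weight P; have w0 := weight_ge0 P : forall A, 0 <= w A.
have root : (fun n => mass w n `^ n%:R^-1) @ \oo --> mu.
  move: hlim_eq; apply: cvg_trans; apply: near_eq_cvg; exists 1%N => // n /= n0.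
  by rewrite prob_size_eq.
have [kappa kappa0 ins] := weight_insert hfe.
have [rho rho0 fill] := weight_fill hd hinv hfe hmarkov.
have ins' A x : animal #|` A|%fset A -> x \in A -> w A <= kappa * w (A `|` cube 1 x)%fset.
  by move=> _; exact: ins.
have fill' n A x : animal n A -> x \in holes A -> w (x |` A)%fset = rho * w A.
  by move=> _; exact: fill.
have [L L0 [N1 few]] := few_full w0 kappa0 ins' hmu0 hmu1 root.
have m0 n : 0 <= mass w n by exact: mass_ge0.
have [N2 mpos] := root_lim_gt0 m0 hmu0 root.
have [n|n|D D0 [N3 step]] := @ratio_step _ _ w rho L (maxn N1 N2) hd w0 rho0 fill' L0.
- by rewrite geq_max => /andP[_]; exact: mpos.
- by rewrite geq_max => /andP[+ _]; exact: few.
have ratio := ratio_limit m0 hmu0 D0 root step.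
have leftE n : mass w n.+1 = n.+1%:R * left_mass w n.+1.
  by apply: mass_left => a A; exact: weight_shift.
have lim1 : (fun n => left_mass w n.+2 / left_mass w n.+1) @ \oo --> mu.
  have shifted : (fun n => mass w n.+2 / mass w n.+1) @ \oo --> mu.
    by rewrite -cvg_shiftS in ratio.
  have h1 : (fun n => 1 - (n.+2%:R)^-1 : R) @ \oo --> (1 : R).
    rewrite -[X in _ --> X]subr0; apply: cvgB; first exact: cvg_cst.
    have := @cvg_harmonic R; rewrite -cvg_shiftS; exact.
  rewrite -[X in _ --> X]mulr1.
  rewrite (_ : (fun n => _) = (fun n => mass w n.+2 / mass w n.+1 * (1 - n.+2%:R^-1))).
    exact: cvgM shifted h1.
  apply/funext => n; rewrite !leftE.
  have -> : (1 - n.+2%:R^-1 : R) = n.+1%:R / n.+2%:R.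
    have n2 : n.+2%:R != 0 :> R by rewrite pnatr_eq0.
    by apply: (mulIf n2); rewrite mulrBl mul1r mulVf // divfK // -natr1 addrK.
  have [->|l0] := eqVneq (left_mass w n.+1) 0; first by rewrite mulr0 invr0 !mulr0 mul0r.
  have n1 : n.+1%:R != 0 :> R by rewrite pnatr_eq0.
  have n2 : n.+2%:R != 0 :> R by rewrite pnatr_eq0.
  move: n.+1%:R n.+2%:R n1 n2 => r s r0 s0.
  by field; rewrite r0 s0 l0.
have lim : (fun n => prob P (size_eq (fun w => left_cluster w 0) n.+2)
    / prob P (size_eq (fun w => left_cluster w 0) n.+1)) @ \oo --> mu.
  by under eq_fun do rewrite !prob_size_eq_left //.
split; rewrite -cvg_shiftS //.
apply: (tail_ratio_limit (a := fun n => prob P (size_eq (fun w => left_cluster w 0) n.+1))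
  (A := fun n => prob P (size_ge_fin (fun w => left_cluster w 0) n.+1))) => //.
- by move=> n; exact: prob_ge0.
- by move=> n; exact: prob_tail.
- exact: prob_tail_cvg0.
exists N2 => n Nn; rewrite prob_size_eq_left //.
have := mpos n.+1 (leqW Nn); rewrite leftE pmulr_rgt0 //.
Unshelve. all: by end_near.
Qed.
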